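(* Let $G$ be a sorted perfect DAG on $V=\{1,\dots,n\}$ and $p\ge1$. Assume the underlying metric on $\mathcal X$ takes the form $d_{\mathcal X}(x,y)^p=\sum_{i\in V}d_{\mathcal X_i}(x_i,y_i)^p$ for all $x,y\in\mathcal X$. If $\mu,\nu\in\mathcal P_p^G(\mathcal X)$, then $$W_{G,p}(\mu,\nu)=AW_p(\mu,\nu).$$
   Context: Directed graphs $G=(V,E)$ have a finite vertex set $V$ and edge set $E\subseteq\{(i,j)\in V\times V: i\neq j\}$; $\mathrm{pa}_i=\{j:(j,i)\in E\}$ is the set of parents of $i$, $\mathrm{an}_i$ is the set of ancestors of $i$ (vertices from which there is a directed path of length at least one to $i$), and $\mathrm{dsc}_i=\{j: i\in\mathrm{an}_j\}$. $G$ is a DAG if $i\notin\mathrm{an}_i$ for all $i$. A DAG on $\{1,\dots,n\}$ is sorted if $i<j$ whenever $i\in\mathrm{pa}_j$. A DAG is perfect if it has no merge, i.e. no triplet $(i,j,k)$ with $j\ne k$, $j,k\in\mathrm{pa}_i$, $j\notin\mathrm{pa}_k$ and $k\notin\mathrm{pa}_j$. To each $i\in V$ are associated Polish spaces $\mathcal X_i,\mathcal Y_i$ with metrics $d_{\mathcal X_i},d_{\mathcal Y_i}$; $\mathcal X=\prod_{i\in V}\mathcal X_i$ and, for $A\subseteq V$, $X_A$ denotes the projection of $X$ onto $\mathcal X_A=\prod_{i\in A}\mathcal X_i$ (similarly for $\mathcal Y$). $\mathcal P(\Omega)$ is the set of Borel probability measures on $\Omega$; $\mathcal P_p(\mathcal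 X)$ the set of $\mu\in\mathcal P(\mathcal X)$ with $\int d_{\mathcal X}(x,x_0)^p\,d\mu(x)<\infty$ for some $x_0$; $\Pi(\mu,\nu)$ the set of couplings. $\mu\in\mathcal P(\mathcal X)$ is $G$-compatible if, for $X\sim\mu$ and every $i\in V$, $X_i$ is conditionally independent of $X_{V\setminus(\mathrm{dsc}_i\cup\{i\})}$ given $X_{\mathrm{pa}_i}$; $\mathcal P^G(\mathcal X)$ is the set of such measures, $\mathcal P_p^G(\mathcal X)=\mathcal P^G(\mathcal X)\cap\mathcal P_p(\mathcal X)$. For $\mu\in\mathcal P^G(\mathcal X)$, $\nu\in\mathcal P^G(\mathcal Y)$: let $G^c$ be the DAG with vertex set $\{i,i':i\in V\}$ ($i'$ a copy of $i$) and edge set $\{(i,j),(i,j'),(i',j'):(i,j)\in E\}\cup\{(i,i'):i\in V\}$, with $\mathcal X_i$ associated to $i$ and $\mathcal Y_i$ to $i'$. The set of $G$-causal couplings is $\Pi_G^c(\mu,\nu)=\Pi(\mu,\nu)\cap\mathcal P^{G^c}(\mathcal X\times\mathcal Y)$. A coupling is $G$-anticausal if its pushforward under $(x,y)\mapsto(y,x)$ lies in $\Pi_G^c(\nu,\mu)$. $\Pi_G^{bc}(\mu,\nu)$ (the $G$-bicausal couplings) is the set of couplings that are both. $W_{G,p}(\mu,\nu)^p=\inf_{\pi\in\Pi_G^{bc}(\mu,\nu)}\int d_{\mathcal X}(x,y)^p\,d\pi(x,y)$ for $\mu,\nu\in\mathcal P_p^G(\mathcal X)$. The adapted Wasserstein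 distance is $AW_p=W_{G_n,p}$ where $G_n=(\{1,\dots,n\},\{(i,j):1\le i<j\le n\})$; every $\mu\in\mathcal P_p(\mathcal X)$ is $G_n$-compatible. *)

(* Defs.v *)
From HB Require Import structures.
From mathcomp Require Import all_boot all_order all_algebra.
From mathcomp Require Import all_classical all_reals all_analysis.

Set Implicit Arguments.
Unset Strict Implicit.
Unset Printing Implicit Defensive.

Import Order.TTheory GRing.Theory Num.Theory.

Local Open Scope classical_set_scope.
Local Open Scope ring_scope.

Section Digraphs.
Context {V : finType}.
Implicit Types E : rel V.

Definition parents E (i : V) : {set V} := [set j | E j i]%SET.

(* [connect E k i] allows the empty path, so the first edge is split off in
   order to get directed paths of length at least one. *)
Definition ancestors E (i : V) : {set V} :=
  [set j | [exists k, E j k && connect E k i]]%SET.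

Definition descendants E (i : V) : {set V} := [set j | i \in ancestors E j]%SET.

(* Acyclicity also rules out self-loops. *)
Definition is_DAG E : Prop := forall i, i \notin ancestors E i.

Definition is_merge E (i j k : V) : Prop :=
  [/\ j != k, j \in parents E i, k \in parents E i,
      j \notin parents E k & k \notin parents E j].

Definition perfect E : Prop := forall i j k, ~ is_merge E i j k.

(* The graph $G^c$: [inl i] is the vertex i and [inr i] its copy i'. *)
Definition causal_graph E : rel (V + V) := fun u v =>
  match u, v with
  | inl i, inl j => E i j
  | inl i, inr j => E i j || (i == j)
  | inr i, inr j => E i j
  | inr _, inl _ => false
  end.

End Digraphs.

Definition sorted_graph n (E : rel 'I_n) : Prop :=
  forall i j, i \in parents E j -> (i < j)%N.

Definition complete_DAG n : rel 'I_n := fun i j => (i < j)%N.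

(* Measurable spaces are pointed in the library; a space carrying a
   probability measure is nonempty anyway. *)
#[short(type="pmetricType")]
HB.structure Definition PointedMetric (R : numDomainType) :=
  {T of Metric R T & isPointed T}.

Definition separable (T : topologicalType) : Prop :=
  exists S : set T, countable S /\ dense S.

Definition complete_metric (R : realType) (M : metricType R) : Prop :=
  forall F : set_system M, ProperFilter F -> cauchy F -> exists x : M, F --> x.

Definition completely_metrizable (R : realType) (T : topologicalType) : Prop :=
  exists (M : metricType R) (f : T -> M) (g : M -> T),
    [/\ complete_metric M, cancel f g, cancel g f, continuous f & continuous g].

(* The given metric of T only has to induce its topology, it need not itself
   be complete. *)
Definition polish (R : realType) (T : pmetricType R) : Prop :=
  separable T /\ completely_metrizable R T.

Definition is_metric (R : realType) (T : Type) (d : T -> T -> R) : Prop :=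
  [/\ forall x y, 0 <= d x y,
      forall x y, d x y = 0 <-> x = y,
      forall x y, d x y = d y x &
      forall x y z, d x z <= d x y + d y z].

(* [prod_topology] alone is not inferred to be a [ptopologicalType]. *)
Definition product_space (I : Type) (T : I -> ptopologicalType) : Type :=
  prod_topology T.

HB.instance Definition _ (I : Type) (T : I -> ptopologicalType) :=
  Topological.copy (product_space T) (prod_topology T).

HB.instance Definition _ (I : Type) (T : I -> ptopologicalType) :=
  Pointed.copy (product_space T) (prod_topology T).

Definition borel (T : ptopologicalType) := g_sigma_algebraType (@open T).

Lemma continuous_borel (T U : ptopologicalType) (f : T -> U) :
  continuous f -> measurable_fun setT (f : borel T -> borel U).
Proof.
move=> /continuousP cf; apply: (@measurability _ _ (borel T) (borel U) setT f (@open U)) => //.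
by move=> _ [B oB <-]; rewrite setTI; apply: sub_sigma_algebra; exact: cf.
Qed.

Section ConditionalIndependence.
Context {R : realType} {d : measure_display} {Omega : measurableType d}.
Variable P : probability Omega R.
Implicit Types F : set (set Omega).

(* g is a version of the conditional probability P(A | F). *)
Definition is_cond_prob F (A : set Omega) (g : Omega -> R) : Prop :=
  [/\ forall B : set R, measurable B -> F (g @^-1` B),
      P.-integrable setT (EFin \o g) &
      forall C, F C -> (\int[P]_(w in C) (g w)%:E = P (A `&` C))%E].

Definition cond_indep F1 F2 F : Prop :=
  forall A1 A2, F1 A1 -> F2 A2 ->
  exists g1 g2 g12 : Omega -> R,
    [/\ is_cond_prob F A1 g1, is_cond_prob F A2 g2,
        is_cond_prob F (A1 `&` A2) g12 &
        {ae P, forall w, g12 w = g1 w * g2 w}].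

End ConditionalIndependence.

Section Compatibility.
Context {R : realType} {V : finType} {T : V -> ptopologicalType}.

Definition subproduct (A : {set V}) : ptopologicalType :=
  product_space (fun i : {i | i \in A} => T (val i)).

Context {d : measure_display} {Omega : measurableType d}.

Definition sigma_of (U : ptopologicalType) (f : Omega -> U) : set (set Omega) :=
  g_sigma_algebra_preimage (f : Omega -> borel U).

Definition restrict_to (X : forall i, Omega -> T i) (A : {set V}) :
  Omega -> subproduct A := fun w i => X (val i) w.

Arguments restrict_to X A w : clear implicits.

Definition compatible (E : rel V) (P : probability Omega R)
    (X : forall i, Omega -> T i) : Prop :=
  forall i, cond_indep P
    (sigma_of (X i))
    (sigma_of (restrict_to X (~: (i |: descendants E i))%SET))
    (sigma_of (restrict_to X (parents E i))).

End Compatibility.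

Section Couplings.
Context {R : realType} {V : finType}.
Implicit Types X Y : V -> ptopologicalType.

Definition path_space X : ptopologicalType := product_space X.

Definition pair_space X Y : Type := (path_space X * path_space Y)%type.

HB.instance Definition _ X Y :=
  Topological.copy (pair_space X Y) (path_space X * path_space Y)%type.

HB.instance Definition _ X Y :=
  Pointed.copy (pair_space X Y) (path_space X * path_space Y)%type.

Definition Prob X : Type := probability (borel (path_space X)) R.

Definition Prob2 X Y : Type := probability (borel (pair_space X Y)) R.

Definition coordinate X (i : V) (x : path_space X) : X i := x i.

Definition ProbG (E : rel V) X : set (Prob X) :=
  [set mu : Prob X | compatible E mu (@coordinate X)].

Definition coupling X Y (mu : Prob X) (nu : Prob Y) : set (Prob2 X Y) :=
  [set pi : Prob2 X Y |
    (forall A : set (borel (path_space X)), measurable A ->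
       pi (fst @^-1` A) = mu A) /\
    (forall B : set (borel (path_space Y)), measurable B ->
       pi (snd @^-1` B) = nu B)].

Definition pair_family X Y (u : V + V) : ptopologicalType :=
  match u with inl i => X i | inr i => Y i end.

(* Together these identify X x Y with the product over the vertices of the
   doubled graph. *)
Definition pair_coordinate X Y (u : V + V) : pair_space X Y -> pair_family X Y u :=
  match u with
  | inl i => fun z => z.1 i
  | inr i => fun z => z.2 i
  end.

Definition causal (E : rel V) X Y (mu : Prob X) (nu : Prob Y) :
    set (Prob2 X Y) :=
  coupling mu nu `&`
  [set pi : Prob2 X Y | compatible (causal_graph E) pi (@pair_coordinate X Y)].

Definition swap_paths X Y (z : borel (pair_space X Y)) : borel (pair_space Y X) :=
  (z.2, z.1).

Lemma measurable_swap_paths X Y : measurable_fun setT (@swap_paths X Y).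
Proof.
apply: (@continuous_borel (pair_space X Y) (pair_space Y X)).
exact: swap_continuous.
Qed.

HB.instance Definition _ X Y :=
  isMeasurableFun.Build _ _ _ _ (@swap_paths X Y) (@measurable_swap_paths X Y).

Definition anticausal (E : rel V) X Y (mu : Prob X) (nu : Prob Y) :
    set (Prob2 X Y) :=
  [set pi : Prob2 X Y | causal E nu mu (distribution pi (@swap_paths X Y))].

Definition bicausal (E : rel V) X Y (mu : Prob X) (nu : Prob Y) :
    set (Prob2 X Y) :=
  causal E mu nu `&` anticausal E mu nu.

End Couplings.

Arguments Prob R {V} X.
Arguments Prob2 R {V} X Y.
Arguments ProbG {R V} E {X}.

Section Wasserstein.
Context {R : realType} {V : finType} {X : V -> ptopologicalType}.
Variables (p : R) (dX : path_space X -> path_space X -> R).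

Definition finite_moment : set (Prob R X) :=
  [set mu : Prob R X | exists x0, (\int[mu]_x (dX x x0 `^ p)%:E < +oo)%E].

Definition ProbGp (E : rel V) : set (Prob R X) :=
  ProbG E `&` finite_moment.

Definition WG (E : rel V) (mu nu : Prob R X) : \bar R :=
  (ereal_inf [set \int[pi]_z (dX z.1 z.2 `^ p)%:E | pi in bicausal E mu nu]
     `^ p^-1)%E.

End Wasserstein.

Definition AW (R : realType) (n : nat) (X : 'I_n -> ptopologicalType) (p : R)
    (dX : path_space X -> path_space X -> R) (mu nu : Prob R X) : \bar R :=
  WG p dX (@complete_DAG n) mu nu.

(* Main.v *)
(** Enlarging the parent sets of a sorted DAG preserves the local Markov
    property, so every G-bicausal coupling is bicausal for the complete DAG,
    which gives AW <= W_G.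

    Conversely, let pi be bicausal for the complete DAG. Resample the pairs
    (x_i, y_i) successively, each from its conditional law under pi given the
    pairs indexed by pa_i only. Perfectness gives pa_i inside {j} u pa_j for
    j = max pa_i, so inductively the joint law of the pairs indexed by
    {i} u pa_i is the one under pi; in particular the cost is unchanged. Since
    mu is G-compatible and pi causal, x_i is drawn from mu(dx_i | x_pa_i), so
    the first marginal is still mu, and similarly for nu.

    Drawing x_i first and then y_i makes each draw depend on the parents in G^c
    only, so the result is G-causal; drawing y_i first makes it G-anticausal.
    Both orders produce the same law, which is therefore G-bicausal.

    A draw is a quantile function applied to uniform noise, after coding each
    Polish space as a Borel retract of the real line. *)

From HB Require Import structures.
Require Import Defs.
From mathcomp Require Import all_boot all_order all_algebra.
From mathcomp Require Import all_classical all_reals all_analysis measurable_realfun.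
From mathcomp Require Import ring lra.

Set Implicit Arguments.
Unset Strict Implicit.
Unset Printing Implicit Defensive.

Import Order.TTheory GRing.Theory Num.Theory.
Import numFieldNormedType.Exports.

Local Open Scope classical_set_scope.
Local Open Scope ring_scope.

(** * Sub-sigma-algebras and conditional probabilities *)

(** Outside the construction of a single draw, conditional laws are not handled as kernels. Laws are
    compared on the sigma-algebras generated by sets of coordinates ([agree]), and conditioning
    enters only in the form that conditional probabilities given many coordinates have versions
    depending on few ([markov]). Gluing of kernels is replaced by a uniqueness principle,
    [agree_markov]: the law of a block together with its past is fixed by the law of the past, the
    law of the block with its parents, and the Markov property. It shows both that redrawing a
    coordinate of [pi] can leave the relevant marginals unchanged and that the two drawing orders
    produce one law.

    A draw overwrites a coordinate on the original space. The construction can therefore start from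
    [pi] itself, and nothing is claimed of coordinates not yet reached. The two orders are
    reconciled after every level, so that each step starts from a single law having both Markov
    properties. *)

Notation sub_measurable G f :=
  (@measurable_fun _ _ (g_sigma_algebraType G) _ setT f).

Section SubSigmaAlgebra.
Context d (Omega : measurableType d) (R : realType).
Implicit Types (P : probability Omega R) (G : set (set Omega)).

Lemma gsub_measurable G : G `<=` measurable -> <<s G >> `<=` @measurable _ Omega.
Proof. by move=> Gm; apply: smallest_sub => //; exact: sigma_algebra_measurable. Qed.

Lemma measurable_to_sub G : G `<=` measurable ->
  measurable_fun setT (id : Omega -> g_sigma_algebraType G).
Proof. by move=> Gm _ A mA; rewrite setTI; exact: (gsub_measurable Gm). Qed.

Lemma measurable_of_sub d' (T : measurableType d') G (f : Omega -> T) :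
  G `<=` measurable -> sub_measurable G f -> measurable_fun setT f.
Proof.
move=> Gm mf _ B mB; rewrite setTI; apply: (gsub_measurable Gm).
by rewrite -[f @^-1` B]setTI; exact: mf.
Qed.

Lemma sub_measurableS d' (T : measurableType d') G H (f : Omega -> T) :
  <<s G >> `<=` <<s H >> -> sub_measurable G f -> sub_measurable H f.
Proof. by move=> GH mf _ B mB; apply: GH; exact: mf. Qed.

(** The restriction of [P] to a smaller sigma-algebra, realised as an image under the identity so
    that change of variables applies to it. *)
Definition trace_prob P G (Gm : G `<=` measurable) :
    probability (g_sigma_algebraType G) R :=
  distribution P (mfun_Sub (mem_set (measurable_to_sub Gm))).

Lemma integral_trace P G (Gm : G `<=` measurable) (f : Omega -> \bar R) C :
  <<s G >> C -> sub_measurable G f -> (forall w, 0 <= f w)%E ->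
  (\int[trace_prob P Gm]_(w in C) f w = \int[P]_(w in C) f w)%E.
Proof.
move=> GC mf f0.
rewrite /trace_prob /distribution ge0_integral_pushforward //.
by apply: measurable_funTS.
Qed.

Lemma integral_agree P1 P2 G (f : Omega -> \bar R) C :
  G `<=` measurable -> (forall A, <<s G >> A -> P1 A = P2 A) ->
  <<s G >> C -> sub_measurable G f -> (forall w, 0 <= f w)%E ->
  (\int[P1]_(w in C) f w = \int[P2]_(w in C) f w)%E.
Proof.
move=> Gm P12 GC mf f0; rewrite -!(integral_trace _ Gm) //.
by apply: eq_measure_integral => A mA _; exact: P12.
Qed.

End SubSigmaAlgebra.

Section Density.
Context d (T : measurableType d) (R : realType).
Variables mu nu : {finite_measure set T -> \bar R}.

(** By its integrals over measurable sets, [h] equals the Radon-Nikodym derivative of [nu] almost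
    everywhere. *)
Lemma integral_density (h g : T -> \bar R) C :
  measurable C -> mu.-integrable setT h -> (forall w, 0 <= h w)%E ->
  (forall D, measurable D -> (\int[mu]_(w in D) h w = nu D)%E) ->
  measurable_fun setT g -> (forall w, 0 <= g w)%E ->
  (\int[mu]_(w in C) (g w * h w) = \int[nu]_(w in C) g w)%E.
Proof.
move=> mC ih h0 hE mg g0.
have numu : nu `<< mu.
  apply/null_content_dominatesP => D mD muD0; rewrite -hE//.
  by apply: null_set_integral => //; exact: measurable_funTS (measurable_int _ ih).
rewrite -(Radon_Nikodym_SigmaFinite.change_of_variables numu) //; last exact: measurable_funTS.
have if_ := Radon_Nikodym_SigmaFinite.f_integrable numu.
have mh := measurable_int _ ih; have mf := measurable_int _ if_.
apply: ae_eq_integral => //.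
- by apply: emeasurable_funM; exact: measurable_funTS.
- by apply: emeasurable_funM; exact: measurable_funTS.
- apply: ae_eqe_mul2l.
  apply: integral_ae_eq => //.
  + exact: (integrableS measurableT).
  + exact: measurable_funTS.
  + by move=> E _ mE; rewrite hE// -Radon_Nikodym_SigmaFinite.f_integral.
Qed.

(** On subsets of [N] both inequalities between the integrals hold, so [f] and [g] agree almost
    everywhere on [N], where they differ at every point. *)
Lemma null_set_of_integral_le (N : set T) (f g : T -> \bar R) :
  measurable N -> mu.-integrable N f -> mu.-integrable N g ->
  (forall w, N w -> g w < f w)%E ->
  (forall E, E `<=` N -> measurable E ->
    \int[mu]_(w in E) f w <= \int[mu]_(w in E) g w)%E ->
  mu N = 0%E.
Proof.
move=> mN intf intg gf le_fg.
have [Z [mZ Z0 NZ]] : ae_eq mu N f g.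
  apply: integral_ae_eq => //; first exact: measurable_int intg.
  move=> E EN mE; apply/eqP; rewrite eq_le le_fg //=.
  have gfE w : E w -> (g w <= f w)%E by move=> /EN /gf /ltW.
  have iE : mu.-integrable E f by exact: (integrableS mN).
  apply: le_integral => //; first exact: integrableS intg.
  by move=> w /set_mem; exact: gfE.
apply/eqP; rewrite -measure_le0 -Z0; apply: le_measure; rewrite ?inE //.
by move=> w Nw; apply: NZ => /= /(_ Nw) fgw; have := gf _ Nw; rewrite fgw ltxx.
Qed.

End Density.

Lemma integrable_unit d (T : measurableType d) (R : realType)
    (P : probability T R) (g : T -> R) (C : set T) : measurable C -> measurable_fun setT g ->
  (forall w, 0 <= g w <= 1) -> P.-integrable C (EFin \o g).
Proof.
move=> mC mg g01; apply: (integrableS measurableT) => //.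
apply: (@le_integrable _ _ _ P _ _ _ (EFin \o cst 1)) => //.
- exact/measurable_EFinP.
- move=> w _ /=; rewrite lee_fin normr1.
  by have /andP[g0 g1] := g01 w; rewrite ger0_norm.
- exact: finite_measure_integrable_cst.
Qed.

Section ConditionalProbability.
Context d (Omega : measurableType d) (R : realType).
Variable P : probability Omega R.
Implicit Types (G : set (set Omega)) (A C : set Omega) (g h : Omega -> R).

(** The measure sending C to P(A and C) on the small sigma-algebra; its density with respect to the
    trace of [P] is the conditional probability of [A]. *)
Definition restricted_trace G (Gm : G `<=` measurable) A (mA : measurable A) :
    set (g_sigma_algebraType G) -> \bar R :=
  pushforward (mrestr P mA) (id : Omega -> g_sigma_algebraType G).

Section Instances.
Variables (G : set (set Omega)) (Gm : G `<=` measurable).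
Variables (A : set Omega) (mA : measurable A).
Let nu := restricted_trace Gm mA.

Let nu0 : nu set0 = 0%E.
Proof. by rewrite /nu /restricted_trace /pushforward preimage_set0 measure0. Qed.

Let nu_ge0 C : (0 <= nu C)%E.
Proof. exact: (measure_ge0 (mrestr P mA)). Qed.

Let nu_sigma : semi_sigma_additive nu.
Proof.
move=> F mF tF mUF.
apply: (@measure_semi_sigma_additive _ _ _ (mrestr P mA)) => //.
  by move=> i; exact: (gsub_measurable Gm (mF i)).
exact: (gsub_measurable Gm mUF).
Qed.

HB.instance Definition _ := isMeasure.Build _ _ _ nu nu0 nu_ge0 nu_sigma.

Let nu_fin : fin_num_fun nu.
Proof.
move=> C mC; apply: (fin_num_measure P); apply: measurableI => //.
exact: (gsub_measurable Gm).
Qed.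

HB.instance Definition _ := Measure_isFinite.Build _ _ _ nu nu_fin.
End Instances.

(** Bounds at every point, not just almost everywhere, make integrability automatic and keep
    products of versions in [0,1]. *)
Definition cond_version G A g :=
  [/\ sub_measurable G g, forall w, 0 <= g w <= 1 &
      forall C, <<s G >> C -> (\int[P]_(w in C) (g w)%:E = P (A `&` C))%E].

Lemma cond_version_exists G A : G `<=` measurable -> measurable A ->
  exists g, cond_version G A g.
Proof.
move=> Gm mA.
pose nu : {finite_measure set (g_sigma_algebraType G) -> \bar R} :=
  restricted_trace Gm mA.
pose mu : {finite_measure set (g_sigma_algebraType G) -> \bar R} :=
  trace_prob P Gm.
have nuE C : nu C = P (A `&` C) by rewrite setIC.
have numuE E : <<s G >> E -> (nu E <= mu E)%E.
  move=> GE; rewrite nuE; apply: le_measure; rewrite ?inE //.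
  - by apply: measurableI => //; exact: (gsub_measurable Gm).
  - exact: (gsub_measurable Gm).
have numu : nu `<< mu.
  apply/null_content_dominatesP => D mD muD0; apply/eqP.
  by rewrite -measure_le0 -muD0; exact: numuE.
have [f [f0 ff intf fE]] := radon_nikodym_sigma_finite numu.
have mf := measurable_int _ intf.
(* The density is at most 1 only almost everywhere; truncation makes the bound hold at every
   point. *)
pose g w := Num.min 1 (fine (f w)).
have mg : sub_measurable G g.
  apply: (@measurable_minr _ (g_sigma_algebraType G)) => //.
  by apply: measurableT_comp => //; exact: measurable_fine.
have g01 w : 0 <= g w <= 1.
  by rewrite /g le_min ler01 fine_ge0//= ge_min lexx.
have fg : ae_eq mu setT f (fun w => (g w)%:E).
  suff N0 : mu [set w | (1 < f w)%E] = 0%E.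
    exists [set w | (1 < f w)%E]; split => //.
      by rewrite -[X in measurable X]setTI; exact: emeasurable_fun_o_infty.
    move=> w /= /not_implyP[_]; apply: contra_notP => /negP; rewrite -leNgt => f1.
    rewrite /g min_r ?fineK //.
    by rewrite -lee_fin fineK.
  set N := [set w | _].
  have mN : G.-sigma.-measurable N.
    by rewrite -[N]setTI; exact: emeasurable_fun_o_infty.
  apply: (@null_set_of_integral_le _ _ _ mu N f (cst 1%E) mN) => //.
  - exact: (integrableS measurableT).
  - exact: finite_measure_integrable_cst.
  - by move=> E EN mE; rewrite -fE// integral_cst// mul1e; exact: numuE.
exists g; split => //.
move=> C GC; rewrite -nuE fE// -(integral_trace P Gm) //; last 2 first.
- exact/measurable_EFinP.
- by move=> w; rewrite lee_fin; case/andP: (g01 w).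
apply: ae_eq_integral => //.
- exact/measurable_funTS/measurable_EFinP.
- exact: measurable_funTS.
- apply: ae_eq_sym; exact: (ae_eq_subset _ fg).
Qed.

(** Since both functions are measurable for the small sigma-algebra, this is uniqueness of densities
    for the trace of [P]. *)
Lemma ae_eq_of_sub_integral G (f1 f2 : Omega -> \bar R) : G `<=` measurable ->
  sub_measurable G f1 -> sub_measurable G f2 ->
  P.-integrable setT f1 -> P.-integrable setT f2 ->
  (forall C, <<s G >> C -> \int[P]_(w in C) f1 w = \int[P]_(w in C) f2 w)%E ->
  ae_eq P setT f1 f2.
Proof.
move=> Gm mf1 mf2 if1 if2 f12.
have mid := measurable_to_sub Gm.
suff [Z [mZ Z0 fZ]] : ae_eq (trace_prob P Gm) setT f1 f2.
  by exists Z; split => //; exact: (gsub_measurable Gm).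
have iE f C : sub_measurable G f -> P.-integrable setT f -> <<s G >> C ->
    (\int[trace_prob P Gm]_(w in C) f w = \int[P]_(w in C) f w)%E.
  move=> mf if_ GC; rewrite /trace_prob /distribution integral_pushforward //.
  apply: integrableS if_ => //.
  exact: (gsub_measurable Gm).
apply: integral_ae_eq => //.
  exact: integrable_pushforward.
by move=> E _ mE; rewrite !iE // f12.
Qed.

Lemma version_le G g1 g2 : G `<=` measurable ->
  sub_measurable G g1 -> sub_measurable G g2 ->
  (forall w, 0 <= g1 w <= 1) -> (forall w, 0 <= g2 w <= 1) ->
  (forall C, <<s G >> C ->
    \int[P]_(w in C) (g1 w)%:E <= \int[P]_(w in C) (g2 w)%:E)%E ->
  P [set w | g2 w < g1 w] = 0%E.
Proof.
move=> Gm mg1 mg2 b1 b2 le12; set N := [set w | _].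
have mN : G.-sigma.-measurable N.
  rewrite -[N]setTI; exact: (@measurable_fun_ltr _ (g_sigma_algebraType G)).
have iE g C : sub_measurable G g -> (forall w, 0 <= g w <= 1) -> <<s G >> C ->
    (\int[trace_prob P Gm]_(w in C) (g w)%:E = \int[P]_(w in C) (g w)%:E)%E.
  move=> mg b GC; apply: integral_trace => //; first exact/measurable_EFinP.
  by move=> w; rewrite lee_fin; case/andP: (b w).
have ig g : sub_measurable G g -> (forall w, 0 <= g w <= 1) ->
    (trace_prob P Gm).-integrable N (EFin \o g).
  by move=> mg b; exact: integrable_unit.
apply: (@null_set_of_integral_le _ _ _ (trace_prob P Gm) N (EFin \o g1) (EFin \o g2)) => //.
- exact: ig.
- exact: ig.
- by move=> E _ mE; rewrite !iE // le12.
Qed.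

Lemma version_ae_eq G g1 g2 : G `<=` measurable ->
  sub_measurable G g1 -> sub_measurable G g2 ->
  (forall w, 0 <= g1 w <= 1) -> (forall w, 0 <= g2 w <= 1) ->
  (forall C, <<s G >> C ->
    \int[P]_(w in C) (g1 w)%:E = \int[P]_(w in C) (g2 w)%:E)%E ->
  ae_eq P setT (EFin \o g1) (EFin \o g2).
Proof.
move=> Gm mg1 mg2 b1 b2 eq12; apply: (ae_eq_of_sub_integral Gm) => //.
- exact/measurable_EFinP.
- exact/measurable_EFinP.
- by apply: integrable_unit => //; exact: (measurable_of_sub Gm).
- by apply: integrable_unit => //; exact: (measurable_of_sub Gm).
Qed.

(** Taking out what is known: both sides integrate [g] against the measure sending C to P(A and C),
    whose density is the indicator of [A] on the full sigma-algebra and [h] on the small one. *)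
Lemma version_pullout G A g h C : G `<=` measurable -> measurable A ->
  cond_version G A h -> sub_measurable G g -> (forall w, 0 <= g w <= 1) ->
  <<s G >> C ->
  (\int[P]_(w in C) (g w * h w)%:E = \int[P]_(w in A `&` C) (g w)%:E)%E.
Proof.
move=> Gm mA [mh h01 hE] mg g01 GC.
have mgT := measurable_of_sub Gm mg.
have mC := gsub_measurable Gm GC.
have g0 w : (0 <= (g w)%:E)%E by rewrite lee_fin; case/andP: (g01 w).
have h0 w : (0 <= (h w)%:E)%E by rewrite lee_fin; case/andP: (h01 w).
rewrite setIC integral_mkcondr.
transitivity (\int[P]_(w in C) ((g w)%:E * (\1_A w)%:E))%E; last first.
  by apply: eq_integral => w _; rewrite epatch_indic.
pose nuA : {finite_measure set Omega -> \bar R} := mrestr P mA.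
rewrite (@integral_density _ _ _ P nuA) //; last 3 first.
- apply: integrable_unit => // w.
  by rewrite indicE; case: (_ \in _); rewrite ?lexx ?ler01.
- by move=> D mD; rewrite integral_indic // setIC.
- exact/measurable_EFinP.
pose nu : {finite_measure set (g_sigma_algebraType G) -> \bar R} :=
  restricted_trace Gm mA.
transitivity (\int[nu]_(w in C) (g w)%:E)%E; last first.
  rewrite /nu /restricted_trace /= ge0_integral_pushforward //.
  - exact: measurable_to_sub.
  - exact/measurable_funTS/measurable_EFinP.
rewrite -(@integral_density _ _ _ (trace_prob P Gm) nu (EFin \o h)) //; last 3 first.
- exact: integrable_unit.
- by move=> D mD; rewrite integral_trace //; [rewrite hE//= setIC|exact/measurable_EFinP].
- exact/measurable_EFinP.
rewrite integral_trace //.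
- by apply: emeasurable_funM; exact/measurable_EFinP.
- by move=> w; exact: mule_ge0 (g0 w) (h0 w).
Qed.

(* When [<<s G >> `<=` <<s G2 >>] this is conditional independence of G1 and G2
   given G: the conditional probability given G is then also one given G2. *)
Definition markov_indep G1 G2 G := forall A, <<s G1 >> A ->
  exists g, [/\ sub_measurable G g, forall w, 0 <= g w <= 1 &
    forall C, <<s G2 >> C -> (\int[P]_(w in C) (g w)%:E = P (A `&` C))%E].

(** The same version serves throughout. Read as conditional independence, this contains weak union:
    part of [G2] may be moved into the conditioning. *)
Lemma markov_indepS G1 G1' G2 G2' G G' :
  <<s G1' >> `<=` <<s G1 >> -> <<s G2' >> `<=` <<s G2 >> ->
  <<s G >> `<=` <<s G' >> -> markov_indep G1 G2 G -> markov_indep G1' G2' G'.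
Proof.
move=> s1 s2 s H A /s1 /H[g [mg g01 gE]]; exists g; split => //.
- exact: sub_measurableS mg.
- by move=> C /s2; exact: gE.
Qed.

Lemma is_cond_probP G A g : G `<=` measurable -> measurable A ->
  is_cond_prob P <<s G >> A g ->
  exists2 h, cond_version G A h & ae_eq P setT (EFin \o g) (EFin \o h).
Proof.
move=> Gm mA [mg ig gE]; have [h hV] := cond_version_exists Gm mA.
have [mh h01 hE] := hV.
exists h => //; apply: (ae_eq_of_sub_integral Gm) => //.
- by apply/measurable_EFinP => _ B mB; rewrite setTI; exact: mg.
- exact/measurable_EFinP.
- by apply: integrable_unit => //; exact: (measurable_of_sub Gm).
- by move=> C GC; rewrite /= gE // hE.
Qed.

Lemma cond_version_is_cond_prob G A h : G `<=` measurable ->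
  cond_version G A h -> is_cond_prob P <<s G >> A h.
Proof.
move=> Gm [mh h01 hE]; split => //.
- by move=> B mB; rewrite -[_ @^-1` _]setTI; exact: mh.
- by apply: integrable_unit => //; exact: (measurable_of_sub Gm).
Qed.

(** One direction integrates the product formula and takes [g] out of the conditional probability of
    [C]. The other shows by [version_pullout] that the product of the versions is a version for the
    intersection. *)
Lemma cond_indep_markov G1 G2 G :
  G1 `<=` measurable -> G2 `<=` measurable -> G `<=` measurable ->
  <<s G >> `<=` <<s G2 >> ->
  cond_indep P <<s G1 >> <<s G2 >> <<s G >> <-> markov_indep G1 G2 G.
Proof.
move=> G1m G2m Gm GG2.
have mE g : sub_measurable G g -> measurable_fun setT (EFin \o g).
  by move=> mg; apply/measurable_EFinP; exact: (measurable_of_sub Gm).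
split=> [ci A G1A|mi A1 A2 G1A1 G2A2].
- have mA := gsub_measurable G1m G1A.
  have [g gV] := cond_version_exists Gm mA; have [mg g01 gE] := gV.
  exists g; split => // C G2C.
  have mC := gsub_measurable G2m G2C.
  have [g1 [g2 [g12 [c1 c2 c12 g12E]]]] := ci _ _ G1A G2C.
  have [g1' V1 e1] := is_cond_probP Gm mA c1.
  have [g2' V2 e2] := is_cond_probP Gm mC c2.
  have [g12' V12 e12] := is_cond_probP Gm (measurableI _ _ mA mC) c12.
  have [mg1' g1'01 g1'E] := V1; have [mg2' g2'01 g2'E] := V2.
  have [mg12' g12'01 g12'E] := V12.
  have GT : <<s G >> setT by exact: (@measurableT _ (g_sigma_algebraType G)).
  have e : ae_eq P setT (EFin \o g) (EFin \o g1').
    by apply: (version_ae_eq Gm) => // D GD; rewrite gE // g1'E.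
  have <- : (\int[P]_w (g12' w)%:E = P (A `&` C))%E by rewrite g12'E // setIT.
  rewrite -[C in LHS]setIT -(version_pullout Gm mC V2 mg g01 GT).
  apply: ae_eq_integral => //.
  + by under eq_fun do rewrite EFinM; apply: emeasurable_funM; exact: mE.
  + exact: mE.
  + near=> w => _ /=.
    have E1 : g1 w = g1' w by apply: EFin_inj; exact: (near e1 w).
    have E2 : g2 w = g2' w by apply: EFin_inj; exact: (near e2 w).
    have E12 : g12 w = g12' w by apply: EFin_inj; exact: (near e12 w).
    have E0 : g w = g1' w by apply: EFin_inj; exact: (near e w).
    rewrite -E12 E0 -E1 -E2; congr EFin; apply/esym; exact: (near g12E w).
- have mA1 := gsub_measurable G1m G1A1; have mA2 := gsub_measurable G2m G2A2.
  have [g [mg g01 gE]] := mi _ G1A1.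
  have [h hV] := cond_version_exists Gm mA2; have [mh h01 hE] := hV.
  exists g, h, (fun w => g w * h w); split.
  + by apply: cond_version_is_cond_prob => //; split => // C /GG2; exact: gE.
  + exact: cond_version_is_cond_prob.
  + apply: cond_version_is_cond_prob => //; split.
    * exact: (@measurable_funM _ (g_sigma_algebraType G)).
    * move=> w; have /andP[g0 g1] := g01 w; have /andP[h0 h1] := h01 w.
      by rewrite mulr_ge0 //= mulr_ile1.
    * move=> C GC; rewrite (version_pullout Gm mA2 hV) // gE ?setIA //.
      by apply: (@measurableI _ (g_sigma_algebraType G2)) => //; exact: GG2.
  + by apply: nearW.
Unshelve. all: by end_near. Qed.

End ConditionalProbability.

(** * Coordinate sigma-algebras *)

Section Coordinates.
Context (W : finType) (T : W -> ptopologicalType).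
Context d (Omega : measurableType d) (c : forall u, Omega -> T u).
Implicit Types A B : {set W}.

(** Generated by events on single coordinates rather than by a map into a product, so that
    inclusions and measurability are checked one coordinate at a time; [sigma_of_restrict]
    identifies the two. *)
Definition gen A : set (set Omega) :=
  [set S | exists2 u, u \in A &
     exists2 B : set (borel (T u)), measurable B & S = c u @^-1` B].

Lemma genS A B : A \subset B -> <<s gen A >> `<=` <<s gen B >>.
Proof.
move=> /fintype.subsetP AB; apply: smallest_sub; first exact: smallest_sigma_algebra.
move=> S [u uA HB]; apply: sub_sigma_algebra.
by exists u => //; exact: AB.
Qed.

Lemma gen_coord A u (B : set (borel (T u))) :
  u \in A -> measurable B -> <<s gen A >> (c u @^-1` B).
Proof. by move=> uA mB; apply: sub_sigma_algebra; exists u => //; exists B. Qed.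

Lemma measurable_into_gen d' (S : measurableType d') A (f : S -> Omega) :
  (forall u, u \in A ->
     measurable_fun setT ((fun s => c u (f s)) : S -> borel (T u))) ->
  measurable_fun setT (f : S -> g_sigma_algebraType (gen A)).
Proof.
move=> mf.
apply: (@measurability _ _ S (g_sigma_algebraType (gen A)) setT f (gen A)) => //.
move=> _ [_ [u uA [B mB ->]] <-].
exact: (mf u uA measurableT B mB).
Qed.

(** The sets that do not separate [w] from [w'] form a sigma-algebra containing the generators. *)
Lemma gen_ext A (S : set Omega) w w' : <<s gen A >> S ->
  (forall u, u \in A -> c u w = c u w') -> S w <-> S w'.
Proof.
move=> GS eqw; move: S GS.
suff : <<s gen A >> `<=` [set S | S w <-> S w'] by [].
apply: smallest_sub.
- split => //=.
  + by move=> S SE; split => -[_ nS]; split => // /SE.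
  + by move=> F FE; split=> -[i _ Fi]; exists i => //; apply/FE.
- by move=> _ [u uA [B mB ->]] /=; rewrite eqw.
Qed.

Lemma gen_fun_ext (R : realType) A (g : Omega -> R) w w' :
  sub_measurable (gen A) g -> (forall u, u \in A -> c u w = c u w') -> g w = g w'.
Proof.
move=> mg eqw; apply/esym.
have := mg measurableT _ (measurable_set1 (g w)); rewrite setTI.
by move=> GS; apply/(gen_ext GS eqw).
Qed.

Hypothesis cm : forall u, measurable_fun setT (c u : Omega -> borel (T u)).

Lemma gen_measurable A : gen A `<=` measurable.
Proof. by move=> _ [u uA [B mB ->]]; rewrite -[X in measurable X]setTI; exact: cm. Qed.

End Coordinates.

(** * Equality of marginals and uniqueness of Markov extensions *)

Section Agreement.
Context (W : finType) (T : W -> ptopologicalType).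
Context d (Omega : measurableType d) (c : forall u, Omega -> T u).
Hypothesis cm : forall u, measurable_fun setT (c u : Omega -> borel (T u)).
Context (R : realType).
Implicit Types (A B D S : {set W}) (P rho : probability Omega R).
Let Gm := gen_measurable cm.

(** Equality of the marginals on the coordinates in [A], stated on the whole space so that no
    projection is formed. *)
Definition agree A P1 P2 := forall C, <<s gen c A >> C -> P1 C = P2 C :> \bar R.

Lemma agreeS A B P1 P2 : A \subset B -> agree B P1 P2 -> agree A P1 P2.
Proof. by move=> AB H C /(genS AB) /H. Qed.

Lemma agree_sym A P1 P2 : agree A P1 P2 -> agree A P2 P1.
Proof. by move=> H C /H. Qed.

Lemma agree_trans A P1 P2 P3 : agree A P1 P2 -> agree A P2 P3 -> agree A P1 P3.
Proof. by move=> H12 H23 C GC; rewrite H12 // H23. Qed.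

(** By [gen_ext] an event over no coordinate contains all points or none. *)
Lemma agree0 P1 P2 : agree finset.set0 P1 P2.
Proof.
have w0 : Omega := point.
move=> C GC; have [Cp|nCp] := pselect (C point).
  have -> : C = setT.
    by apply/seteqP; split=> // w _; apply: (gen_ext GC _).1 Cp => u; rewrite inE.
  by rewrite !probability_setT.
have -> : C = set0.
  apply/seteqP; split=> // w Cw; apply: nCp.
  by apply: (gen_ext GC _).1 Cw => u; rewrite inE.
by rewrite !measure0.
Qed.

(** Intersections of an event over [S] with one over [D] form a pi-system generating the
    sigma-algebra over the union. *)
Lemma agree_setU S D P1 P2 :
  (forall A C : set Omega, <<s gen c S >> A -> <<s gen c D >> C -> P1 (A `&` C) = P2 (A `&` C)) ->
  agree (S :|: D) P1 P2.
Proof.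
move=> H.
pose G := [set Z | exists A C : set Omega, [/\ <<s gen c S >> A, <<s gen c D >> C & Z = A `&` C]].
have GT A : <<s gen c A >> setT by exact: (@measurableT _ (g_sigma_algebraType (gen c A))).
suff eqG : forall E, <<s G >> E -> P1 E = P2 E.
  move=> C GC; apply: eqG; move: C GC; apply: smallest_sub.
    exact: smallest_sigma_algebra.
  move=> _ [u + [B mB ->]]; rewrite finset.in_setU => uSD; apply: sub_sigma_algebra; case/orP: uSD => [uS|uD].
  - exists (c u @^-1` B), setT; split; rewrite ?setIT //.
    exact: gen_coord.
  - exists setT, (c u @^-1` B); split; rewrite ?setTI //.
    exact: gen_coord.
apply: (g_sigma_algebra_measure_unique G _ (fun=> setT)) => //.
- move=> _ [A [C [GA GC ->]]].
  by apply: measurableI; apply: (gsub_measurable (@Gm _)); eassumption.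
- by move=> _; exists setT, setT; rewrite setTI.
- by rewrite bigcup_const.
- move=> _ _ [A [C [GA GC ->]]] [A' [C' [GA' GC' ->]]].
  exists (A `&` A'), (C `&` C'); split.
  + exact: (@measurableI _ (g_sigma_algebraType (gen c S))).
  + exact: (@measurableI _ (g_sigma_algebraType (gen c D))).
  + by rewrite setIACA.
- by move=> _ [A [C [GA GC ->]]]; exact: H.
- by move=> ? /=; rewrite probability_setT ltry.
Qed.

Lemma agree_integral A P1 P2 (g : Omega -> R) C :
  agree A P1 P2 -> sub_measurable (gen c A) g -> (forall w, 0 <= g w <= 1) ->
  <<s gen c A >> C ->
  (\int[P1]_(w in C) (g w)%:E = \int[P2]_(w in C) (g w)%:E)%E.
Proof.
move=> H mg g01 GC; apply: (integral_agree (@Gm A)) => //.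
- exact/measurable_EFinP.
- by move=> w; rewrite lee_fin; case/andP: (g01 w).
Qed.

Definition markov P S D B := markov_indep P (gen c S) (gen c D) (gen c B).

Lemma markovS P S S' D D' B B' : S' \subset S -> D' \subset D -> B \subset B' ->
  markov P S D B -> markov P S' D' B'.
Proof. by move=> SS DD BB; apply: markov_indepS; exact: genS. Qed.

Lemma markov_agree P1 P2 S D B : B \subset D -> agree (S :|: D) P1 P2 ->
  markov P1 S D B -> markov P2 S D B.
Proof.
move=> BD H12 M A SA; have [g [mg g01 gE]] := M A SA; exists g; split => // C DC.
have H12D : agree D P1 P2 := agreeS (finset.subsetUr _ _) H12.
rewrite -(agree_integral H12D) //; last exact: sub_measurableS (genS BD) mg.
rewrite gE // H12 //.
apply: (@measurableI _ (g_sigma_algebraType (gen c (S :|: D)))).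
- exact: (genS (finset.subsetUl _ _) SA).
- exact: (genS (finset.subsetUr _ _) DC).
Qed.

(** Given [D], the block [S] has the conditional law it has given [B], and this one can be read off
    the marginal on [S :|: B]; integrating it over the common marginal on [D] yields the joint
    law. *)
Lemma agree_markov P1 P2 S D B : B \subset D ->
  markov P1 S D B -> markov P2 S D B ->
  agree D P1 P2 -> agree (S :|: B) P1 P2 -> agree (S :|: D) P1 P2.
Proof.
move=> BD M1 M2 HD HS; apply: agree_setU => A C SA DC.
have [g1 [mg1 b1 E1]] := M1 A SA; have [g2 [mg2 b2 E2]] := M2 A SA.
have HB : agree B P1 P2 by exact: agreeS HD.
have mG (g : Omega -> R) : sub_measurable (gen c B) g -> measurable_fun setT (EFin \o g).
  by move=> mg; apply/measurable_EFinP; exact: (measurable_of_sub (@Gm _) mg).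
have e : ae_eq P1 setT (EFin \o g1) (EFin \o g2).
  apply: (version_ae_eq (@Gm B)) => // C' BC'.
  rewrite E1; last exact: (genS BD).
  rewrite (agree_integral HB) // E2; last exact: (genS BD).
  apply: HS; apply: (@measurableI _ (g_sigma_algebraType (gen c (S :|: B)))).
  - exact: (genS (finset.subsetUl _ _) SA).
  - exact: (genS (finset.subsetUr _ _) BC').
have mC := gsub_measurable (@Gm _) DC.
rewrite -E1 // -E2 // -(agree_integral HD) //; last exact: sub_measurableS (genS BD) mg2.
apply: ae_eq_integral => //.
- exact: measurable_funTS (mG _ mg1).
- exact: measurable_funTS (mG _ mg2).
- exact: ae_eq_subset e.
Qed.

End Agreement.

(** * Resampling one coordinate *)

(** Used with [f] the identity between two sigma-algebras on one set: what is measurable for the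
    coarser product is measurable for the finer one. [Z'] is kept apart from [Z] because the two
    live in different measurable types. *)
Lemma measurable_prodS d1 d2 dN (S1 : measurableType d1) (S2 : measurableType d2)
    (N : measurableType dN) (f : S1 -> S2) (Z : set (S2 * N)) (Z' : set (S1 * N)) :
  measurable_fun setT f -> measurable Z -> (forall w x, Z' (w, x) <-> Z (f w, x)) ->
  measurable Z'.
Proof.
move=> mf mZ ZZ'.
have mfN : measurable_fun setT (fun z : S1 * N => (f z.1, z.2)).
  apply/measurable_fun_pairP; split; last exact: measurable_snd.
  exact: (measurableT_comp mf measurable_fst).
have -> : Z' = setT `&` (fun z : S1 * N => (f z.1, z.2)) @^-1` Z.
  by rewrite setTI; apply/seteqP; split=> -[w x] /ZZ'.
exact: mfN.
Qed.

Section Resampling.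
Context (W : finType) (T : W -> ptopologicalType).
Context d (Omega : measurableType d) (c : forall u, Omega -> T u).
Hypothesis cm : forall u, measurable_fun setT (c u : Omega -> borel (T u)).
Hypothesis gen_full : measurable `<=` <<s gen c (finset.setT) >>.
Context (R : realType).
Implicit Types (A B D S : {set W}) (P rho : probability Omega R).
Let Gm := gen_measurable cm.

(* [U] replaces the coordinate [v] by a draw from its conditional law under [pi]
   given the coordinates in [pa]. *)
Record resampler (v : W) (pa : {set W}) (pi : probability Omega R)
    (U : probability Omega R -> probability Omega R) : Prop := Resampler {
  resample_other : forall rho A, v \notin A -> agree c A (U rho) rho ;
  resample_agree : forall rho rho' A, pa \subset A -> agree c A rho rho' ->
    agree c (v |: A) (U rho) (U rho') ;
  resample_fix : agree c (v |: pa) (U pi) pi ;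
  resample_dual : forall S (h : Omega -> R), pa \subset S -> v \notin S ->
    sub_measurable (gen c (v |: S)) h -> (forall w, 0 <= h w <= 1) ->
    exists g : Omega -> R, [/\ sub_measurable (gen c S) g,
      forall w, 0 <= g w <= 1 &
      forall rho D C, v \notin D -> <<s gen c D >> C ->
        (\int[U rho]_(w in C) (h w)%:E = \int[rho]_(w in C) (g w)%:E)%E] ;
  resample_markov : forall rho S A B, pa \subset A -> v \notin A ->
    v \notin S -> v \notin B -> markov c rho S A B ->
    markov c (U rho) S (v |: A) B }.

Lemma measurable_genS A B : A \subset B ->
  measurable_fun setT
    (id : g_sigma_algebraType (gen c B) -> g_sigma_algebraType (gen c A)).
Proof. by move=> AB _ Z mZ; rewrite setTI; exact: (genS AB). Qed.

(** * Overwriting one coordinate with the help of independent noise *)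

Section Update.
Context dN (N : measurableType dN) (lam : probability N R).
Variables (v : W) (pa : {set W}) (m : Omega * N -> Omega).
Hypothesis m_other : forall u z, u != v -> c u (m z) = c u z.1.
Hypothesis m_self : measurable_fun setT
  ((fun z => c v (m z)) : (g_sigma_algebraType (gen c pa) * N)%type -> borel (T v)).

Lemma measurable_update A : pa \subset A ->
  measurable_fun setT
    (m : (g_sigma_algebraType (gen c A) * N)%type ->
         g_sigma_algebraType (gen c (v |: A))).
Proof.
move=> paA; apply: measurable_into_gen => u.
have [->|uv] := eqVneq u v.
  move=> _ _ B mB.
  exact: (measurable_prodS (measurable_genS paA) (m_self measurableT mB)).
rewrite in_setU1 (negbTE uv) /= => uA.
under eq_fun do rewrite m_other //.
have mcu : measurable_fun setT (c u : g_sigma_algebraType (gen c A) -> borel (T u)).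
  by move=> _ B mB; rewrite setTI; exact: gen_coord.
exact: (measurableT_comp mcu (@measurable_fst _ _ (g_sigma_algebraType (gen c A)) N)).
Qed.

Lemma measurable_updateT : measurable_fun setT m.
Proof.
move=> _ B mB; rewrite setTI.
have := @measurable_update finset.setT (finset.subsetT _) measurableT B.
rewrite setTI => H.
apply: (measurable_prodS (measurable_to_sub (@Gm finset.setT)) (H _)) => //.
apply: genS (gen_full mB).
exact: finset.subsetUr.
Qed.

Definition update_law rho : probability Omega R :=
  distribution (rho \x lam)%E (mfun_Sub (mem_set measurable_updateT)).

Lemma update_ext A C z : v \notin A -> <<s gen c A >> C -> C (m z) <-> C z.1.
Proof.
move=> vA GC; apply: (gen_ext GC) => u uA; apply: m_other.
by apply: contraNneq vA => <-.
Qed.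

Lemma update_fun_ext A (g : Omega -> R) z : v \notin A ->
  sub_measurable (gen c A) g -> g (m z) = g z.1.
Proof.
move=> vA mg; apply: (gen_fun_ext mg) => u uA; apply: m_other.
by apply: contraNneq vA => <-.
Qed.

Lemma update_other rho A : v \notin A -> agree c A (update_law rho) rho.
Proof.
move=> vA C GC; rewrite /update_law /distribution /pushforward /=.
have -> : m @^-1` C = C `*` setT.
  apply/seteqP; split=> z /=; first by move=> /(update_ext z vA GC).
  by case=> + _; move=> /(update_ext z vA GC).
rewrite product_measure1E //; last exact: (gsub_measurable (@Gm _) GC).
by rewrite [X in (_ * X)%E](_ : _ = 1%E) ?mule1 //; exact: probability_setT.
Qed.

(** The new mass of [C] is the [rho]-integral of the noise measure of its sections, a function of
    the coordinates in [A] alone. *)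
Lemma update_agree rho rho' A : pa \subset A -> agree c A rho rho' ->
  agree c (v |: A) (update_law rho) (update_law rho').
Proof.
move=> paA H C GC; rewrite /update_law /distribution /pushforward /=.
rewrite /product_measure1.
apply: (integral_agree (@Gm A)) => //.
  exact: (@measurableT _ (g_sigma_algebraType (gen c A))).
apply: (@measurable_fun_xsection _ _ (g_sigma_algebraType (gen c A)) N R lam).
by rewrite -[_ @^-1` _]setTI; exact: measurable_update.
Qed.

Lemma integral_update rho (h : Omega -> R) C : measurable C ->
  measurable_fun setT h -> (forall w, 0 <= h w)  ->
  (\int[update_law rho]_(w in C) (h w)%:E =
   \int[(rho \x lam)%E]_(z in m @^-1` C) (h (m z))%:E)%E.
Proof.
move=> mC mh h0; rewrite /update_law /distribution ge0_integral_pushforward //.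
- by apply/measurable_funTS/measurable_EFinP.
- by move=> w _; rewrite lee_fin.
Qed.

(** [g] averages [h] over the noise. It depends neither on [rho] nor on [D], so this dual action on
    functions can be iterated when draws are composed. *)
Lemma update_dual S (h : Omega -> R) : pa \subset S -> v \notin S ->
  sub_measurable (gen c (v |: S)) h -> (forall w, 0 <= h w <= 1) ->
  exists g : Omega -> R, [/\ sub_measurable (gen c S) g,
    forall w, 0 <= g w <= 1 &
    forall rho D C, v \notin D -> <<s gen c D >> C ->
      (\int[update_law rho]_(w in C) (h w)%:E = \int[rho]_(w in C) (g w)%:E)%E].
Proof.
move=> paS vS mh h01.
pose F w := (\int[lam]_x (h (m (w, x)))%:E)%E.
have mhm : measurable_fun setT ((fun z => (h (m z))%:E) :
    (g_sigma_algebraType (gen c S) * N)%type -> \bar R).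
  apply/measurable_EFinP.
  exact: (measurableT_comp mh (measurable_update paS)).
have mF : sub_measurable (gen c S) F.
  apply: (@measurable_fun_fubini_tonelli_F _ _ (g_sigma_algebraType (gen c S)) N R lam
    (fun z => (h (m z))%:E)) => // z.
  by rewrite lee_fin; case/andP: (h01 (m z)).
have F0 w : (0 <= F w)%E.
  by apply: integral_ge0 => x _; rewrite lee_fin; case/andP: (h01 (m (w, x))).
have F1 w : (F w <= 1)%E.
  rewrite /F -(@probability_setT _ _ _ lam) -[leRHS]mul1e -integral_cst //.
  apply: ge0_le_integral => //.
  - by move=> x _; rewrite lee_fin; case/andP: (h01 (m (w, x))).
  - exact: (@measurable_fun_pair2 _ _ _ (g_sigma_algebraType (gen c S)) N _ _ w mhm).
  - by move=> x _; rewrite lee_fin; case/andP: (h01 (m (w, x))).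
have Ff w : F w \is a fin_num.
  by rewrite ge0_fin_numE // (le_lt_trans (F1 w)) ?ltry.
exists (fun w => fine (F w)); split.
- by apply: measurableT_comp => //; exact: measurable_fine.
- by move=> w; rewrite fine_ge0 //= -lee_fin fineK.
move=> rho D C vD DC.
have mC := gsub_measurable (@Gm _) DC.
have mhT := measurable_of_sub (@Gm _) mh.
rewrite integral_update // => [|w]; last by case/andP: (h01 w).
have mCm : measurable (m @^-1` C).
  by rewrite -[_ @^-1` _]setTI; exact: measurable_updateT.
rewrite integral_mkcond fubini_tonelli1; last 2 first.
- apply/(measurable_restrictT _ mCm).
  by apply/measurable_funTS/measurable_EFinP; exact: (measurableT_comp mhT measurable_updateT).
- by move=> z; rewrite patchE; case: ifP => // _; rewrite lee_fin; case/andP: (h01 (m z)).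
rewrite [RHS]integral_mkcond; apply: eq_integral => w _.
(* [C] does not involve [v], so whether [m (w, x)] lies in it does not depend on the noise [x]. *)
rewrite /fubini_F patchE fineK //; case: ifPn => wC.
- apply: eq_integral => x _; rewrite patchE ifT // inE /=.
  by apply/(update_ext (w, x) vD DC); exact: set_mem.
- rewrite integral0_eq // => x _; rewrite patchE ifF //.
  apply/negP => /set_mem /= /(update_ext (w, x) vD DC) /= /mem_set.
  by rewrite (negbTE wC).
Qed.

(** With the noise frozen, the preimage of [C] is an event over [A], to which the version [g] for
    [rho] applies. As [v] is in neither [S] nor [B], the update affects neither [Z] nor [g]. *)
Lemma update_markov rho S A B : pa \subset A -> v \notin A ->
  v \notin S -> v \notin B -> markov c rho S A B ->
  markov c (update_law rho) S (v |: A) B.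
Proof.
move=> paA vA vS vB M Z SZ; have [g [mg g01 gE]] := M Z SZ.
exists g; split => // C AC.
have mC := gsub_measurable (@Gm _) AC; have mZ := gsub_measurable (@Gm _) SZ.
have mgT := measurable_of_sub (@Gm _) mg.
have mCm : measurable ((m @^-1` C) : set (g_sigma_algebraType (gen c A) * N)).
  by rewrite -[_ @^-1` _]setTI; exact: measurable_update.
have mCmT : measurable (m @^-1` C).
  by rewrite -[_ @^-1` _]setTI; exact: measurable_updateT.
have mZm : measurable (m @^-1` Z).
  by rewrite -[_ @^-1` _]setTI; exact: measurable_updateT.
have g0 w : 0 <= g w by case/andP: (g01 w).
rewrite integral_update //.
have -> : update_law rho (Z `&` C) = (\int[(rho \x lam)%E]_(z in m @^-1` C) (\1_Z (m z))%:E)%E.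
  rewrite -(integral_update rho mC) // integral_indic //.
rewrite integral_mkcond [RHS]integral_mkcond.
have mp (k : Omega -> R) : measurable_fun setT k ->
    measurable_fun setT ((fun z => (k (m z))%:E) \_ (m @^-1` C)).
  move=> mk; apply/(measurable_restrictT _ mCmT).
  by apply/measurable_funTS/measurable_EFinP; exact: (measurableT_comp mk measurable_updateT).
have p0 (k : Omega -> R) : (forall w, 0 <= k w) ->
    forall z, (0 <= ((fun z => (k (m z))%:E) \_ (m @^-1` C)) z)%E.
  by move=> k0 z; rewrite patchE; case: ifP => // _; rewrite lee_fin.
have i0 w : 0 <= \1_Z w :> R by [].
(* The integrals are exchanged so that the inner one runs over [w] at a fixed noise value. *)
rewrite !fubini_tonelli1 ?fubini_tonelli //;
  [|exact: mp|exact: p0|exact: mp|exact: p0|exact: mp|exact: p0|exact: mp|exact: p0].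
apply: eq_integral => x _; rewrite /fubini_G.
pose Cx := ysection (m @^-1` C) x.
have ACx : <<s gen c A >> Cx by exact: (@measurable_ysection _ _ (g_sigma_algebraType (gen c A)) N).
transitivity (\int[rho]_(w in Cx) (g w)%:E)%E.
  rewrite [RHS]integral_mkcond; apply: eq_integral => w _.
  rewrite !patchE mem_ysection; case: ifP => // _.
  by rewrite (update_fun_ext (w, x) vB mg).
rewrite gE // -(@integral_indic _ _ _ rho Cx _ Z) //; last exact: (gsub_measurable (@Gm _) ACx).
rewrite integral_mkcond; apply: eq_integral => w _.
rewrite !patchE mem_ysection; case: ifP => // _; congr EFin; rewrite !indicE.
congr (nat_of_bool _)%:R; apply/idP/idP => /set_mem H; apply/mem_set.
- exact/(update_ext (w, x) vS SZ).
- exact: (update_ext (w, x) vS SZ).1.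
Qed.

Lemma update_resampler pi : agree c (v |: pa) (update_law pi) pi ->
  resampler v pa pi update_law.
Proof.
move=> fixpi; split => //.
- exact: update_other.
- exact: update_agree.
- exact: update_dual.
- exact: update_markov.
Qed.

End Update.

End Resampling.

(** * Quantile functions and codes of Polish spaces *)

Section Quantile.
Context (R : realType).

Lemma uniform_prob_le (t : R) : 0 <= t <= 1 ->
  uniform_prob (@ltr01 R) [set x | x <= t] = t%:E.
Proof.
move=> /andP[t0 t1].
have -> : [set x | x <= t] = `]-oo, t]%classic.
  by apply/seteqP; split=> x /=; rewrite in_itv.
rewrite /uniform_prob integral_uniform_pdf.
have -> : (`]-oo, t] `&` `[0, 1] : set R)%classic = `[0, t]%classic.
  apply/seteqP; split=> x /=; rewrite !in_itv /=.
    by case=> -> /andP[-> _].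
  by move=> /andP[-> xt]; rewrite xt (le_trans xt t1).
rewrite (eq_integral (fun=> 1%E)).
  rewrite integral_cst //= mul1e.
  rewrite lebesgue_measure_itv /= lte_fin.
  by case: ltP => [_|t0']; [rewrite sube0|rewrite (@le_anti _ _ t 0) // t0 t0'].
move=> x; rewrite inE /= in_itv /= => /andP[x0 xt].
by rewrite /uniform_pdf x0 (le_trans xt t1) subr0 invr1.
Qed.

(* [uniform_prob] lives on the carrier [measurableTypeR], whose measurable
   structure is not the canonical one of [R]. *)
Lemma uniform_measure_exists : exists lam : probability R R,
  forall t : R, 0 <= t <= 1 -> lam [set x | x <= t] = t%:E.
Proof.
have mid : @measurable_fun _ _ (measurableTypeR R) R setT id.
  by move=> _ B mB; rewrite setTI.
pose U : probability (measurableTypeR R) R := uniform_prob (@ltr01 R).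
exists (@distribution _ _ (measurableTypeR R) R R U
  (@mfun_Sub _ _ (measurableTypeR R) R id (mem_set mid))) => t t01.
exact: uniform_prob_le.
Qed.

(** Runs through the rationals of [0,1]; an index that decodes to anything else gives 0, so that the
    bounds hold for every index. *)
Definition unit_rat (k : nat) : R :=
  let r := ratr (odflt 0 (unpickle k : option rat)) in
  if 0 <= r <= 1 then r else 0.

Lemma unit_rat01 k : 0 <= unit_rat k <= 1.
Proof. by rewrite /unit_rat; case: ifP => //; rewrite lexx ler01. Qed.

Lemma unit_rat_dense a b : 0 <= a -> a < b -> b <= 1 ->
  exists k, a <= unit_rat k < b.
Proof.
move=> a0 ab b1; have [q] := rat_in_itvoo ab.
rewrite in_itv /= => /andP[aq qb]; exists (pickle q).
rewrite /unit_rat pickleK /= (le_trans a0 (ltW aq)) (ltW (lt_le_trans qb b1)) /=.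
by rewrite (ltW aq) qb.
Qed.

(** Serves to collapse a finite union of events increasing with the rational to a single event, the
    one at the largest rational below [t]. *)
Lemma unit_rat_argmax (t : R) n : (forall k, (k < n)%N -> t <= unit_rat k) \/
  exists k0, [/\ (k0 < n)%N, unit_rat k0 < t &
    forall k, (k < n)%N -> unit_rat k < t -> unit_rat k <= unit_rat k0].
Proof.
elim: n => [|n IH]; first by left.
have [tn|nt] := leP t (unit_rat n).
- case: IH => [IH|[k0 [k0n k0t IH]]].
    left=> k; rewrite ltnS leq_eqVlt => /predU1P[->//|]; exact: IH.
  right; exists k0; split => //; first exact: ltnW.
  move=> k; rewrite ltnS leq_eqVlt => /predU1P[->|]; last exact: IH.
  by rewrite ltNge tn.
- right; case: IH => [IH|[k0 [k0n k0t IH]]].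
    exists n; split => // k; rewrite ltnS leq_eqVlt => /predU1P[->//|kn].
    by rewrite ltNge IH.
  have [nk|kn] := leP (unit_rat n) (unit_rat k0).
    exists k0; split => //; first exact: ltnW.
    by move=> k; rewrite ltnS leq_eqVlt => /predU1P[->//|]; exact: IH.
  exists n; split => // k; rewrite ltnS leq_eqVlt => /predU1P[->//|kn' kt].
  exact: le_trans (IH _ kn' kt) (ltW kn).
Qed.

Lemma measure_eq_rays (m1 m2 : {measure set R -> \bar R}) :
  (m1 setT < +oo)%E ->
  (forall t, m1 [set x | x < t] = m2 [set x | x < t]) ->
  forall B, measurable B -> m1 B = m2 B.
Proof.
move=> fin1 H B mB.
have {mB} : <<s @RGenInftyO.G R >> B.
  have : (@ocitv R).-sigma.-measurable B by exact: mB.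
  by rewrite RGenInftyO.measurableE.
move: B.
have rayE (x : R) : `]-oo, x[%classic = [set y | y < x].
  by apply/seteqP; split=> y /=; rewrite in_itv.
apply: (g_sigma_algebra_measure_unique (@RGenInftyO.G R) _ (fun n => `]-oo, n%:R[%classic)).
- by move=> _ [x ->]; exact: measurable_itv.
- by move=> i; exists i%:R.
- apply/seteqP; split=> // x _; exists (Num.truncn `|x|).+1 => //=.
  by rewrite in_itv /= (le_lt_trans (ler_norm x)) // truncnS_gt.
- move=> _ _ [x ->] [y ->]; exists (Num.min x y).
  by apply/seteqP; split=> z /=; rewrite !in_itv /= lt_min => /andP.
- by move=> _ [x ->]; rewrite rayE; exact: H.
- by move=> k; apply: le_lt_trans fin1; apply: le_measure; rewrite ?inE.
Qed.

Lemma unit_rat_between z t : 0 <= z <= 1 -> z < t -> exists k, z <= unit_rat k < t.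
Proof.
move=> /andP[z0 z1] zt; have [t1|t1] := leP t 1; first exact: unit_rat_dense.
(* Here [t] exceeds 1, so the rational 1 itself lies between [z] and [t]. *)
exists (pickle (1 : rat)).
by rewrite /unit_rat pickleK /= rmorph1 ler01 lexx /= z1.
Qed.

Context d (Omega : measurableType d) (P : probability Omega R).
Variable lam : probability R R.
Hypothesis lamE : forall t : R, 0 <= t <= 1 -> lam [set x | x <= t] = t%:E.
Variables (G : set (set Omega)) (Gm : G `<=` measurable).
Variables (Z : Omega -> R) (mZ : measurable_fun setT Z).
Hypothesis Z01 : forall w, 0 <= Z w <= 1.

Let below t := [set w | Z w <= t].

Let mbelow t : measurable (below t).
Proof.
rewrite (_ : below t = Z @^-1` `]-oo, t]%classic).
  by rewrite -[X in measurable X]setTI; apply: mZ => //; exact: measurable_itv.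
by apply/seteqP; split=> w /=; rewrite /below /= in_itv.
Qed.

(** The conditional distribution function of [Z] at rational points. Countably many comparisons fail
    on one null set, which belongs to [<<s G >>], so versions may be altered there without losing
    measurability. *)
Lemma monotone_versions : exists g : nat -> Omega -> R,
  (forall k, cond_version P G [set w | Z w <= unit_rat k] (g k)) /\
  (forall k l w, unit_rat k <= unit_rat l -> g k w <= g l w).
Proof.
have [g gV] := choice (fun k => cond_version_exists P Gm (mbelow (unit_rat k))).
pose bad k l := [set w | unit_rat k <= unit_rat l /\ g l w < g k w].
pose N := \bigcup_k \bigcup_l bad k l.
have mg k : sub_measurable G (g k) by case: (gV k).
have g01 k w : 0 <= g k w <= 1 by case: (gV k).
have mbad k l : <<s G >> (bad k l).
  have [kl|lk] := boolP (unit_rat k <= unit_rat l); last first.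
    rewrite (_ : bad k l = set0); first exact: sigma_algebra0.
    by apply/seteqP; split=> // w []; rewrite (negbTE lk).
  rewrite (_ : bad k l = [set w | g l w < g k w]).
    by rewrite -[X in <<s _ >> X]setTI; exact: (@measurable_fun_ltr _ (g_sigma_algebraType G)).
  by apply/seteqP; split=> [w []|w gw] //; split.
have mN : <<s G >> N.
  apply: (@bigcupT_measurable _ (g_sigma_algebraType G)) => k.
  by apply: (@bigcupT_measurable _ (g_sigma_algebraType G)) => l; exact: mbad.
have bad0 k l : P (bad k l) = 0%E.
  have [kl|lk] := boolP (unit_rat k <= unit_rat l); last first.
    rewrite (_ : bad k l = set0) ?measure0 //.
    by apply/seteqP; split=> // w []; rewrite (negbTE lk).
  rewrite (_ : bad k l = [set w | g l w < g k w]).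
    apply: (version_le Gm) => // C GC.
    have [_ _ ->] // := gV k; have [_ _ ->] // := gV l.
    apply: le_measure; rewrite ?inE.
    + by apply: (measurableI _ _ (mbelow _) (gsub_measurable Gm GC)).
    + by apply: (measurableI _ _ (mbelow _) (gsub_measurable Gm GC)).
    + by apply: setSI => w /= wk; exact: le_trans kl.
  by apply/seteqP; split=> [w []|w gw] //; split.
have N0 : P.-negligible N.
  apply: negligible_bigcup => k; apply: negligible_bigcup => l.
  exists (bad k l); split; [exact: (gsub_measurable Gm (mbad k l))|exact: bad0|by []].
(* On the exceptional set the uniform distribution function is substituted: it is monotone, with
   values in [0,1]. *)
pose g' k w := if w \in N then unit_rat k else g k w.
have mg' k : sub_measurable G (g' k).
  apply: (@measurable_fun_ifT _ _ (g_sigma_algebraType G)) => //.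
  apply: (@measurable_fun_bool _ (g_sigma_algebraType G) _ _ true).
  rewrite setTI (_ : _ @^-1` _ = N) //.
  by apply/seteqP; split=> w /=; [move/set_mem|move/mem_set].
exists g'; split=> [k|k l w kl].
  split => //.
  - by move=> w; rewrite /g'; case: ifP => _; [exact: unit_rat01|].
  - move=> C GC; have [_ _ <-] // := gV k.
    apply: ae_eq_integral => //.
    + exact: (gsub_measurable Gm).
    + by apply/measurable_funTS/measurable_EFinP; exact: (measurable_of_sub Gm (mg' k)).
    + by apply/measurable_funTS/measurable_EFinP; exact: (measurable_of_sub Gm (mg k)).
    + case: N0 => A [mA A0 NA]; exists A; split => // w /= nE; apply: NA.
      apply: contra_notP nE => wN _; rewrite /g' ifF //.
      by apply/negP => /set_mem.
rewrite /g'; case: ifPn => // wN; rewrite leNgt; apply/negP => lt_g.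
by move/negP: wN; apply; apply/mem_set; exists k => //; exists l.
Qed.

(** [Q] is the conditional quantile of [Z] at level given by the noise: the infimum of the rationals
    whose conditional distribution function reaches that level. Then [Q < t] means that some
    rational below [t] passes the test, which happens with the right conditional probability by
    [lamE]. *)
Lemma quantile_sampler : exists Q : Omega * R -> R,
  measurable_fun setT (Q : (g_sigma_algebraType G * R)%type -> R) /\
  forall C B, <<s G >> C -> measurable B ->
    (P \x lam)%E ((C `*` setT) `&` Q @^-1` B) =
    P (C `&` Z @^-1` B).
Proof.
have [g [gV gmono]] := monotone_versions.
have mg k : sub_measurable G (g k) by case: (gV k).
have g01 k w : 0 <= g k w <= 1 by case: (gV k).
(* The value 2 stands for infinity: a rational failing the test cannot lower the infimum, and the
   infimum is 2 when all fail. *)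
pose h k (z : Omega * R) := if z.2 <= g k z.1 then unit_rat k else 2.
have h_lb z : has_lbound (range (h ^~ z)).
  exists 0 => _ [k _ <-]; rewrite /h; case: ifP => // _.
  by case/andP: (unit_rat01 k).
have mle k : measurable_fun setT
    ((fun z => z.2 <= g k z.1) : (g_sigma_algebraType G * R)%type -> bool).
  apply: (@measurable_fun_ler _ (g_sigma_algebraType G * R)%type) => //.
  exact: (measurableT_comp (mg k) measurable_fst).
have mh k : measurable_fun setT (h k : (g_sigma_algebraType G * R)%type -> R).
  exact: (@measurable_fun_ifT _ _ (g_sigma_algebraType G * R)%type).
pose Q z := infs (h ^~ z) 0.
have mQ : measurable_fun setT (Q : (g_sigma_algebraType G * R)%type -> R).
  exact: (@measurable_fun_infs _ (g_sigma_algebraType G * R)%type).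
exists Q; split => // C B GC mB.
have mC := gsub_measurable Gm GC.
have mQT : measurable_fun setT Q.
  move=> _ D mD; apply: (measurable_prodS (measurable_to_sub Gm) (mQ measurableT _ mD)).
  by [].
pose PL : probability (Omega * R)%type R := (P \x lam)%E.
have mCT : measurable (C `*` [set: R]) by exact: measurableX.
have mPL t : PL ((C `*` setT) `&` Q @^-1` [set x | x < t]) = P (C `&` Z @^-1` [set x | x < t]).
  have mE k : measurable [set z : Omega * R | z.2 <= g k z.1].
    rewrite -[X in measurable X]setTI.
    apply: (@measurable_fun_ler _ (Omega * R)%type) => //.
    exact: (measurableT_comp (measurable_of_sub Gm (mg k)) measurable_fst).
  (* Only the first [n] rationals are used at a time, so that by monotonicity a single one decides;
     continuity from below then removes the restriction. *)
  pose K n := [set k | (k < n)%N /\ unit_rat k < t].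
  pose F n := (C `*` [set: R]) `&` \bigcup_(k in K n) [set z | z.2 <= g k z.1].
  pose D n := C `&` \bigcup_(k in K n) below (unit_rat k).
  have mF n : measurable (F n).
    by apply: measurableI => //; apply: bigcup_measurable => k _.
  have mD n : measurable (D n).
    by apply: measurableI => //; apply: bigcup_measurable => k _.
  have KS n n' k : (n <= n')%N -> K n k -> K n' k.
    by move=> nn' [kn kt]; split => //; exact: leq_trans nn'.
  have ndF : nondecreasing_seq F.
    move=> n n' nn'; apply/subsetPset; apply: setIS => z [k Kk kz].
    by exists k => //; exact: KS Kk.
  have ndD : nondecreasing_seq D.
    move=> n n' nn'; apply/subsetPset; apply: setIS => z [k Kk kz].
    by exists k => //; exact: KS Kk.
  have FD n : PL (F n) = P (D n).
    have [noK|[k0 [k0n k0t k0max]]] := unit_rat_argmax t n.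
      have K0 : K n = set0.
        by apply/seteqP; split=> // k [kn]; rewrite ltNge noK.
      by rewrite /F /D K0 !bigcup_set0 !setI0 !measure0.
    have -> : D n = below (unit_rat k0) `&` C.
      rewrite /D setIC; congr (_ `&` _); apply/seteqP; split=> [w [k [kn kt] wk]|w wk].
        exact: le_trans wk (k0max _ kn kt).
      by exists k0.
    have [_ _ <-] // := gV k0.
    have -> : F n = (C `*` [set: R]) `&` [set z | z.2 <= g k0 z.1].
      rewrite /F; congr (_ `&` _); apply/seteqP; split=> [z [k [kn kt] zk]|z zk].
        exact: le_trans zk (gmono _ _ _ (k0max _ kn kt)).
      by exists k0.
    rewrite /PL /= /product_measure1 [RHS]integral_mkcond; apply: eq_integral => w _.
    rewrite patchE /=; case: ifPn => wC.
      rewrite -(lamE (g01 k0 w)); congr (lam _).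
      apply/seteqP; split=> x; rewrite /xsection /= inE /=; first by case.
      by move=> xg; split => //; split => //; exact: set_mem.
    rewrite (_ : xsection _ _ = set0) ?measure0 //.
    apply/seteqP; split=> x //; rewrite /xsection /= inE /= => -[[wC' _] _].
    by move/negP: wC; apply; exact/mem_set.
  have -> : (C `*` setT) `&` Q @^-1` [set x | x < t] =
      if 2 < t then C `*` setT else \bigcup_n F n.
    have QE z : Q z < t <-> exists k, h k z < t.
      have := @infs_preimage R _ setT t h 0%N (fun z _ => h_lb z).
      rewrite !setTI => /seteqP[S1 S2]; split.
      - move=> Qt; have [|k _] := S1 z; first by rewrite /= in_itv.
        by rewrite /= in_itv /=; exists k.
      - move=> [k kt]; have := S2 z; rewrite /= in_itv /=; apply.
        by exists k => //=; rewrite in_itv.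
    have h2 k z : h k z <= 2.
      rewrite /h; case: ifP => // _; case/andP: (unit_rat01 k) => _ /le_trans; apply.
      by rewrite ler1n.
    case: ifPn => t2.
      rewrite setIidl // => z _; apply/QE; exists 0%N; exact: le_lt_trans t2.
    rewrite -leNgt in t2; apply/seteqP; split=> z.
      move=> [zC /QE[k]]; rewrite /h; case: ifP => [zk kt|_]; last by rewrite ltNge t2.
      by exists k.+1 => //; split => //; exists k => //; split.
    move=> [n _ [zC [k [kn kt] zk]]]; split => //; apply/QE; exists k.
    by rewrite /h zk.
  (* For [t] beyond 2 the ray contains all values of [Q] and [Z], and both sides are the mass of
     [C]. *)
  case: ifPn => t2.
    rewrite /PL /= product_measure1E // [X in (_ * X)%E](_ : _ = 1%E); last exact: probability_setT.
    rewrite mule1 setIidl // => w _ /=; have /andP[_ Zw1] := Z01 w.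
    by rewrite (le_lt_trans Zw1) // (lt_trans _ t2) // ltr1n.
  have cF := nondecreasing_cvg_mu (mu := PL) mF (bigcup_measurable (fun n _ => mF n)) ndF.
  have cD := nondecreasing_cvg_mu (mu := P) mD (bigcup_measurable (fun n _ => mD n)) ndD.
  have FDE : PL \o F = P \o D by apply/funext => n; exact: FD.
  rewrite FDE in cF; rewrite -(cvg_lim _ cF) // (cvg_lim _ cD) //.
  congr (P _); apply/seteqP; split=> w.
    by move=> [n _ [wC [k [kn kt] wk]]]; split => //; exact: le_lt_trans wk kt.
  move=> [wC wt]; have [k /andP[wk kt]] := unit_rat_between (Z01 w) wt.
  by exists k.+1 => //; split => //; exists k => //; split.
suff : pushforward (mrestr PL mCT) Q B = pushforward (mrestr P mC) Z B.
  by rewrite /pushforward /mrestr setIC => ->; rewrite setIC.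
apply: measure_eq_rays => //.
- change (PL (Q @^-1` setT `&` (C `*` [set: R])) < +oo)%E.
  rewrite preimage_setT setTI.
  by rewrite (le_lt_trans (probability_le1 PL mCT)) // ltry.
- move=> t; change (PL (Q @^-1` [set x | x < t] `&` (C `*` [set: R])) =
    P (Z @^-1` [set x | x < t] `&` C)).
  by rewrite setIC mPL setIC.
Qed.

End Quantile.

(** * Base 4 codes of bit sequences *)

Section BinaryCode.
Context (R : realType).
Implicit Types b : nat -> bool.

Fixpoint bits_nat b n : nat :=
  if n is m.+1 then (4 * bits_nat b m + b m)%N else 0%N.

Definition bits_approx b n : R := (bits_nat b n)%:R / 4 ^+ n.

(* Base 4 rather than 2: the tail of the expansion is at most a third of the
   last digit's unit, so that every digit can be read off the sum. *)
Definition bits_code b : R := sup (range (bits_approx b)).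

(** The nonnegative reals t for which the integer part of 4^(k+1) t is odd. The digits of a code are
    0 or 1, so this parity is its digit [k]. *)
Definition digit_set k : set R :=
  \bigcup_(n in [set n | odd n]) `[n%:R / 4 ^+ k.+1, n.+1%:R / 4 ^+ k.+1[%classic.

Lemma measurable_digit_set k : measurable (digit_set k).
Proof. by apply: bigcup_measurable => n _; exact: measurable_itv. Qed.

Lemma pow4_gt0 n : 0 < 4 ^+ n :> R. Proof. by rewrite exprn_gt0. Qed.

Lemma bits_approxS b n :
  bits_approx b n.+1 = bits_approx b n + (b n)%:R / 4 ^+ n.+1.
Proof.
rewrite /bits_approx /= natrD natrM mulrDl; congr (_ + _).
by rewrite exprS; field; rewrite gt_eqF // pow4_gt0.
Qed.

Lemma bits_approx_nd b : nondecreasing_seq (bits_approx b).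
Proof.
by apply/nondecreasing_seqP => n; rewrite bits_approxS lerDl divr_ge0.
Qed.

(** The factor [3^-1] is the sum of the powers 4^(-j) over j at least 1; the subtracted term is what
    makes the induction close. *)
Lemma bits_approx_tail b n m :
  bits_approx b (n + m) <= bits_approx b n + 3^-1 * ((4 ^+ n)^-1 - (4 ^+ (n + m))^-1).
Proof.
elim: m => [|m IH]; first by rewrite addn0 subrr mulr0 addr0.
rewrite addnS bits_approxS.
have t0 : 0 < (4 ^+ (n + m).+1)^-1 :> R by rewrite invr_gt0 pow4_gt0.
have e : (4 ^+ (n + m))^-1 = 4 * (4 ^+ (n + m).+1)^-1 :> R.
  by rewrite exprS invfM mulrA mulfV ?mul1r // pnatr_eq0.
have b1 : (b (n + m))%:R / 4 ^+ (n + m).+1 <= (4 ^+ (n + m).+1)^-1 :> R.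
  by case: (b _); rewrite ?mul1r // mul0r ltW.
rewrite e in IH; lra.
Qed.

Lemma bits_approx_ub b n m :
  bits_approx b m <= bits_approx b n + 3^-1 * (4 ^+ n)^-1.
Proof.
have p0 k : 0 <= (4 ^+ k)^-1 :> R by rewrite invr_ge0 ltW // pow4_gt0.
have [mn|nm] := leqP m n.
  by rewrite (le_trans (bits_approx_nd b mn)) // lerDl mulr_ge0 // invr_ge0.
rewrite -(subnKC (ltnW nm)); apply: le_trans (bits_approx_tail _ _ _) _.
by rewrite lerD2l ler_wpM2l // gerBl.
Qed.

Lemma has_ubound_bits b : has_ubound (range (bits_approx b)).
Proof. by exists (bits_approx b 0 + 3^-1 * (4 ^+ 0)^-1) => _ [m _ <-]; exact: bits_approx_ub. Qed.

Lemma bits_code_ge b n : bits_approx b n <= bits_code b.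
Proof. by apply: ub_le_sup; [exact: has_ubound_bits|exists n]. Qed.

Lemma bits_code_le b n : bits_code b <= bits_approx b n + 3^-1 * (4 ^+ n)^-1.
Proof.
apply: ge_sup; first by exists (bits_approx b 0); exists 0%N.
by move=> _ [m _ <-]; exact: bits_approx_ub.
Qed.

Lemma bits_code01 b : 0 <= bits_code b <= 1.
Proof.
have := bits_code_ge b 0; have := bits_code_le b 0.
rewrite /bits_approx /= expr0 invr1 !mulr1 add0r => le1 ge0.
rewrite ge0 (le_trans le1) // invf_le1 //; by rewrite ler1n.
Qed.

(** The tail is less than one unit of the last digit, so 4^(k+1) times the code has integer part
    [bits_nat b k.+1], whose parity is [b k]. *)
Lemma digit_code b k : digit_set k (bits_code b) <-> b k.
Proof.
have p0 := pow4_gt0 k.+1.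
set N := bits_nat b k.+1.
have bN : odd N = b k by rewrite /N /= oddD oddM /= oddb.
have lb : N%:R <= bits_code b * 4 ^+ k.+1.
  by rewrite -ler_pdivrMr //; exact: (bits_code_ge b k.+1).
have ub : bits_code b * 4 ^+ k.+1 < N.+1%:R.
  rewrite -ltr_pdivlMr //; apply: le_lt_trans (bits_code_le b k.+1) _.
  rewrite /bits_approx -/N -mulrDl ltr_pM2r ?invr_gt0 // -[N.+1%:R]natr1 ltrD2l.
  by rewrite invf_lt1 // ltr1n.
split.
- move=> [n /= oddn]; rewrite in_itv /= ler_pdivrMr // ltr_pdivlMr // => nb.
  by rewrite -bN -(truncn_def (n := N) (x := bits_code b * 4 ^+ k.+1)) ?lb //
             (truncn_def nb).
- move=> bk; exists N => /=; first by rewrite bN.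
  by rewrite in_itv /= ler_pdivrMr // ltr_pdivlMr // lb ub.
Qed.

Lemma measurable_bits_code d (T : measurableType d) (b : T -> nat -> bool) :
  (forall k, measurable [set x | b x k]) ->
  measurable_fun setT (fun x => bits_code (b x)).
Proof.
move=> mb.
have mbk k : measurable_fun setT (fun x => b x k).
  by apply: (measurable_fun_bool true); rewrite setTI; exact: mb.
rewrite (_ : (fun x => _) = (fun x => sups ((fun n x => bits_approx (b x) n) ^~ x) 0)).
  apply: measurable_fun_sups => [x _|]; first exact: has_ubound_bits.
  elim=> [|n IH].
    by rewrite /bits_approx /= mul0r; exact: measurable_cst.
  under eq_fun do rewrite bits_approxS; apply: measurable_funD => //.
  rewrite (_ : (fun x => _) = (fun x => if b x n then (4 ^+ n.+1)^-1 else 0)).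
    exact: measurable_fun_ifT.
  by apply/funext => x; case: (b x n); rewrite ?mul1r ?mul0r.
apply/funext => x; rewrite /sups /= /bits_code /sdrop; congr sup.
by apply/seteqP; split=> _ [n _ <-]; exists n.
Qed.

End BinaryCode.

(** * Borel codes of Polish spaces *)

Section PolishCode.
Context (R : realType).

Lemma invn_lt (e : R) : 0 < e -> exists k : nat, k.+1%:R^-1 < e.
Proof.
move=> e0; exists (Num.truncn e^-1).
by rewrite invf_plt ?posrE // truncnS_gt.
Qed.

Lemma dense_seq (X : ptopologicalType) : separable X ->
  exists s : nat -> X, forall U, open U -> U !=set0 -> exists m, U (s m).
Proof.
move=> [S [cS dS]].
have [S0|/set0P S0] := eqVneq S set0.
  exists (fun=> point) => U oU U0; have := dS U U0 oU.
  by rewrite S0 setI0 => -[].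
have [f finj] := countable_injP _ cS.
have [s sE] : exists s : nat -> X, forall x, S x -> s (f x) = x.
  have sur m : exists x : X, forall y, S y -> f y = m -> x = y.
    have [[y [Sy fy]]|noy] := pselect (exists y, S y /\ f y = m).
      by exists y => z Sz fz; apply: finj; rewrite ?inE // fz fy.
    by exists point => y Sy fy; exfalso; apply: noy; exists y.
  have [s sP] := choice sur.
  by exists s => x Sx; exact: sP.
exists s => U oU U0; have [x [Ux Sx]] := dS U U0 oU.
by exists (f x); rewrite sE.
Qed.

Lemma open_mdist_lt (M : metricType R) (y : M) (r : R) :
  open [set z | mdist y z < r].
Proof.
rewrite openE => z yz; rewrite /interior -nbhs_ballE.
exists (r - mdist y z) => /=; first by rewrite subr_gt0.
rewrite ballEmdist => w /= zw.
by rewrite (le_lt_trans (metric_triangle y z w)) // -ltrBrDl.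
Qed.

(** [g] is defined on all of [R] because a quantile may fall outside the range of [f]; the bounds on
    [f] are those that [quantile_sampler] asks for. *)
Definition borel_code (X : ptopologicalType) := exists (f : X -> R) (g : R -> X),
  [/\ measurable_fun setT (f : borel X -> R), measurable_fun setT (g : R -> borel X),
      forall x, 0 <= f x <= 1 & cancel f g].

(** A point is coded by the bits telling which balls of radius 1/(k+1) about a dense sequence
    contain it, and recovered as a limit of centres of such balls. The recovery needs completeness,
    so distances are taken in [M] and not in [X]. *)
Lemma polish_borel_code (X : pmetricType R) : polish X -> borel_code X.
Proof.
move=> [sepX [M [phi [psi [cM phiK psiK cphi cpsi]]]]].
have [s sD] := dense_seq sepX.
pose y m : M := phi (s m).
have yD (z : M) e : 0 < e -> exists m, mdist z (y m) < e.
  move=> e0; have [||m] := sD (phi @^-1` [set w | mdist z w < e]).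
  - by apply: open_comp => [x _|]; [exact: cphi|exact: open_mdist_lt].
  - by exists (psi z) => /=; rewrite psiK mdistxx.
  - by exists m.
pose r k : R := k.+1%:R^-1.
have r0 k : 0 < r k by rewrite invr_gt0.
pose b (x : X) (j : nat) := if unpickle j is Some km then mdist (y km.2) (phi x) < r km.1
  else false.
pose dg (k m : nat) : set R := digit_set (pickle (k, m)).
have mdg k m : measurable (dg k m) by exact: measurable_digit_set.
(* Necessary conditions on a code: a ball at every scale, and centres as close as the triangle
   inequality demands. They suffice for decoding and, being countably many conditions on digits,
   define a Borel set. *)
pose D := [set t : R | (forall k, exists m, dg k m t) /\
  forall k m k' m', dg k m t -> dg k' m' t ->
    mdist (y m) (y m') <= r k + r k'].
have lim_ex t : exists z : M, D t -> forall k m, dg k m t ->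
    mdist (y m) z <= r k.
  have [Dt|nDt] := pselect (D t); last by exists (phi point).
  (* One ball is chosen at each scale; the second condition of [D] makes the centres a Cauchy
     sequence. *)
  have [m mP] := choice Dt.1.
  have [z yz] : exists z : M, (y \o m) @ \oo --> z.
    apply: (cM ((y \o m) @ \oo) _); apply: cauchy_exP => e e0.
    have e20 : 0 < e / 2 by rewrite divr_gt0.
    have [k ke] := invn_lt e20; exists (y (m k)).
    exists k => // l /= kl; rewrite ballEmdist /=.
    rewrite (le_lt_trans (Dt.2 _ _ _ _ (mP k) (mP l))) // [e]splitr ltrD //.
    apply: le_lt_trans ke; rewrite lef_pV2 ?posrE // ler_nat.
    by rewrite ltnS.
  exists z => _ k n kn; apply/ler_addgt0Pl => e e0.
  have e20 : 0 < e / 2 by rewrite divr_gt0.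
  have [k' ke] := invn_lt e20.
  have [l [kl lz]] : exists l, (k' <= l)%N /\ mdist z (y (m l)) < e / 2.
    have /yz [N _ HN] : nbhs z (ball z (e / 2)) by exact: nbhsx_ballx.
    exists (maxn N k'); split; first exact: leq_maxr.
    by have := HN (maxn N k') (leq_maxl _ _); rewrite /= ballEmdist.
  apply: le_trans (metric_triangle _ (y (m l)) _) _.
  have rl : r l <= e / 2.
    by apply: le_trans (ltW ke); rewrite lef_pV2 ?posrE // ler_nat ltnS.
  have := Dt.2 _ _ _ _ kn (mP l); rewrite metric_sym in lz; lra.
have mD : measurable D.
  pose ok k m k' m' := mdist (y m) (y m') <= r k + r k'.
  rewrite (_ : D = (\bigcap_k \bigcup_m dg k m) `&`
      \bigcap_k \bigcap_m \bigcap_k' \bigcap_m'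
        (if ok k m k' m' then setT else
           ~` (dg k m `&` dg k' m'))).
    apply: measurableI.
      apply: bigcapT_measurable => k; apply: bigcupT_measurable => m.
      exact: mdg.
    do 4!apply: bigcapT_measurable => ?.
    case: ifP => // _; apply: measurableC.
    by apply: measurableI; exact: mdg.
  apply/seteqP; split=> [t [D1 D2]|t [D1 D2]]; split.
  - by move=> k _; have [m mt] := D1 k; exists m.
  - move=> k _ m _ k' _ m' _; case: ifPn => // nok [t1 t2].
    by move/negP: nok; apply; exact: D2.
  - by move=> k; have [m _ mt] := D1 k I; exists m.
  - move=> k m k' m' t1 t2; have := D2 k I m I k' I m' I.
    by rewrite -/(ok k m k' m'); case: ifP => // _ /= []; split.
have [g0 g0P] := choice lim_ex.
pose g t := if t \in D then psi (g0 t) else point.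
exists (fun x => bits_code R (b x)), g; split.
- apply: (@measurable_bits_code _ _ (borel X)) => j; rewrite /b.
  case: (unpickle j) => [[k m]|]; last first.
    by rewrite (_ : [set _ | _] = set0); [exact: measurable0|apply/seteqP; split].
  apply: sub_sigma_algebra => /=.
  by apply: (@open_comp _ _ phi [set w | mdist (y m) w < r k]) => [x _|];
     [exact: cphi|exact: open_mdist_lt].
- apply: (@measurability _ _ R (borel X) setT g (@open X)) => //.
  move=> _ [U oU <-]; rewrite setTI.
  (* As [U] is open, membership of the decoded point is witnessed by a single digit whose closed
     ball is sent into [U], which makes the preimage a countable union. *)
  pose good k m := `[< forall z, mdist (y m) z <= r k -> U (psi z) >].
  rewrite (_ : g @^-1` U =
      (D `&` \bigcup_k \bigcup_m (if good k m then dg k m else set0))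
      `|` (if point \in U then ~` D else set0)).
    apply: measurableU.
      apply: measurableI => //; do 2!apply: bigcupT_measurable => ?.
      by case: ifP => // _; exact: mdg.
    by case: ifP => // _; exact: measurableC.
  apply/seteqP; split=> t /=; rewrite /g.
  + case: ifPn => [/set_mem Dt Ut|/negP nDt Ut]; last first.
      by right; rewrite mem_set //= => Dt; apply: nDt; exact: mem_set.
    left; split => //.
    have oUM : open (psi @^-1` U) by move/continuousP: cpsi; exact.
    have : nbhs (g0 t) (psi @^-1` U) by exact: open_nbhs_nbhs.
    rewrite -nbhs_ballE => -[e /= e0]; rewrite ballEmdist => eU.
    have e20 : 0 < e / 2 by rewrite divr_gt0.
    have [k ke] := invn_lt e20; have [m mt] := Dt.1 k.
    exists k => //; exists m => //; rewrite ifT //; apply/asboolP => z zk.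
    apply: eU => /=; apply: le_lt_trans (metric_triangle _ (y m) _) _.
    have := g0P t Dt k m mt; rewrite (metric_sym (g0 t)) => H.
    by rewrite [e]splitr ltrD // (le_lt_trans _ ke).
  + case=> [[Dt [k _ [m _]]]|].
      case: ifP => // /asboolP gd mt; rewrite mem_set //; apply: gd.
      exact: g0P.
    case: ifPn => // /set_mem pU nDt; rewrite ifF //.
    by apply/negP => /set_mem.
- by move=> x; exact: bits_code01.
- move=> x; set t := bits_code R (b x).
  have dE k m : dg k m t <-> mdist (y m) (phi x) < r k.
    by rewrite /dg digit_code /b pickleK.
  have Dt : D t.
    split.
      move=> k; have [m xm] := yD (phi x) _ (r0 k).
      by exists m; apply/dE; rewrite metric_sym.
    move=> k m k' m' /dE xm /dE xm'.
    apply: le_trans (metric_triangle _ (phi x) _) _.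
    by rewrite lerD // ltW // metric_sym.
  rewrite /g mem_set //; apply: (can_inj phiK); rewrite psiK.
  apply: mdist_positivity; apply/eqP; rewrite eq_le mdist_ge0 andbT.
  apply/ler_addgt0Pl => e e0; rewrite addr0.
  have e20 : 0 < e / 2 by rewrite divr_gt0.
  have [k ke] := invn_lt e20.
  have [m mt] := Dt.1 k.
  have H1 := g0P t Dt k m mt; have H2 := (dE k m).1 mt.
  apply: le_trans (metric_triangle _ (y m) _) _.
  rewrite metric_sym [e]splitr lerD // ltW //; first exact: le_lt_trans H1 ke.
  exact: lt_trans H2 ke.
Qed.

End PolishCode.

(** * Existence and composition of resamplers *)

Section ResamplerExistence.
Context (W : finType) (T : W -> ptopologicalType).
Context d (Omega : measurableType d) (c : forall u, Omega -> T u).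
Hypothesis cm : forall u, measurable_fun setT (c u : Omega -> borel (T u)).
Hypothesis gen_full : measurable `<=` <<s gen c (finset.setT) >>.
Context (R : realType).
Implicit Types (A B D S : {set W}) (P rho : probability Omega R).
Let Gm := gen_measurable cm.

Lemma gen1P v (A : set Omega) : <<s gen c [set v]%SET >> A <->
  exists2 B : set (borel (T v)), measurable B & A = c v @^-1` B.
Proof.
split=> [|[B mB ->]]; last by apply: gen_coord => //; rewrite finset.in_set1.
suff : <<s gen c [set v]%SET >> `<=` preimage_set_system setT (c v) (@measurable _ (borel (T v))).
  by move=> /[apply] -[B mB]; rewrite setTI => <-; exists B.
apply: smallest_sub.
  by apply: sigma_algebra_preimage; exact: sigma_algebra_measurable.
move=> _ [u uv [B mB ->]]; move: uv B mB; rewrite finset.in_set1 => /eqP -> B mB.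
by exists B => //; rewrite setTI.
Qed.

Lemma indic_unit (Z : set Omega) (w : Omega) : 0 <= (\1_Z w : R) <= 1.
Proof. by rewrite indicE; case: (_ \in _); rewrite ?lexx ?ler01. Qed.

Lemma sub_measurable_indic A Z : <<s gen c A >> Z ->
  sub_measurable (gen c A) (\1_Z : Omega -> R).
Proof. by move=> AZ; exact: (@measurable_indic _ (g_sigma_algebraType (gen c A))). Qed.

Section Properties.
Variables (v : W) (pa : {set W}) (pi : probability Omega R).
Variable U : probability Omega R -> probability Omega R.
Hypotheses (vpa : v \notin pa) (rU : resampler c v pa pi U).

(** The dual of the indicator of [Z], taken with [S] equal to [pa], is the required version. *)
Lemma resample_markov_self rho D : v \notin D -> markov c (U rho) [set v]%SET D pa.
Proof.
move=> vD Z SZ.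
have mZ := gsub_measurable (@Gm _) SZ.
have [||g [mg g01 gE]] := resample_dual rU (S := pa) (h := \1_Z) (subxx _) vpa.
- apply: sub_measurable_indic; apply: genS SZ; exact: finset.subsetUl.
- exact: indic_unit.
exists g; split => // C DC.
have mC := gsub_measurable (@Gm _) DC.
have paD : v \notin pa :|: D by rewrite finset.in_setU negb_or vpa.
have HD := resample_other rU rho paD.
rewrite (agree_integral cm HD) //; last 2 first.
- exact: sub_measurableS (genS (finset.subsetUl _ _)) mg.
- exact: (genS (finset.subsetUr _ _) DC).
by rewrite -(gE _ D) // integral_indic.
Qed.

(** Under [pi] the coordinate [v] already depends on [D] only through [pa], so by [agree_markov]
    redrawing it changes nothing on [v |: D]. *)
Lemma resample_fix_ext D : v \notin D -> pa \subset D -> markov c pi [set v]%SET D pa ->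
  agree c (v |: D) (U pi) pi.
Proof.
move=> vD paD M; apply: (agree_markov cm paD _ M).
- exact: (resample_markov_self _ vD).
- exact: (resample_other rU _ vD).
- exact: resample_fix rU.
Qed.

End Properties.

(** The dual of the second draw turns the indicator of [Z] into a function over [a |: B], and the
    dual of the first turns that into one over [B]. *)
Lemma two_step_markov a b pa pb pi (Ua Ub : probability Omega R -> probability Omega R)
    rho B D :
  resampler c a pa pi Ua -> resampler c b pb pi Ub ->
  pa \subset B -> pb \subset a |: B -> a != b ->
  a \notin B -> b \notin B -> a \notin D -> b \notin D ->
  markov c (Ub (Ua rho)) [set a; b]%SET D B.
Proof.
move=> rUa rUb paB pbB ab aB bB aD bD Z SZ.
have mZ := gsub_measurable (@Gm _) SZ.
have [|||g1 [mg1 g101 g1E]] := resample_dual rUb (S := a |: B) (h := \1_Z) pbB.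
- by rewrite in_setU1 negb_or eq_sym ab.
- apply: sub_measurable_indic; apply: genS SZ.
  apply/fintype.subsetP => u; rewrite !finset.inE => /orP[] -> //.
  by rewrite orbT.
- exact: indic_unit.
have [|||g [mg g01 gE]] := resample_dual rUa (S := B) (h := g1) paB => //.
exists g; split => // C DC.
have mC := gsub_measurable (@Gm _) DC.
have HD : agree c (B :|: D) (Ub (Ua rho)) rho.
  apply: agree_trans (resample_other rUb _ _) (resample_other rUa _ _).
  - by rewrite finset.in_setU negb_or bB.
  - by rewrite finset.in_setU negb_or aB.
rewrite (agree_integral cm HD) //; last 2 first.
- exact: sub_measurableS (genS (finset.subsetUl _ _)) mg.
- exact: (genS (finset.subsetUr _ _) DC).
by rewrite -(gE _ D) // -(g1E _ D) // integral_indic.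
Qed.

Variable upd : forall v, Omega -> T v -> Omega.
Hypothesis upd_self : forall v w t, c v (@upd v w t) = t.
Hypothesis upd_other : forall u v w t, u != v -> c u (@upd v w t) = c u w.

(** The coordinate is coded into [0,1], drawn there by the conditional quantile, and decoded. Only
    the fixed point property at [pi] rests on the choice of the quantile; the others hold for any
    measurable update. *)
Lemma resampler_exists v (pa : {set W}) (pi : probability Omega R) :
  borel_code R (T v) -> v \notin pa -> exists U, resampler c v pa pi U.
Proof.
move=> [f [g [mf mg f01 fK]]] vpa.
have [lam lamE] := uniform_measure_exists R.
have mZ : measurable_fun setT (fun w => f (c v w)) by move=> _ B mB; have := cm measurableT (mf measurableT _ mB); rewrite !setTI.
have [Q [mQ QE]] := @quantile_sampler R _ Omega pi lam lamE
  (gen c pa) (@Gm pa) _ mZ (fun w => f01 (c v w)).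
pose m (z : Omega * R) := @upd v z.1 (g (Q z)).
have m_other u z : u != v -> c u (m z) = c u z.1 by move=> uv; rewrite upd_other.
have m_self : measurable_fun setT
    ((fun z => c v (m z)) : (g_sigma_algebraType (gen c pa) * R)%type -> borel (T v)).
  rewrite (_ : (fun z => c v (m z)) = g \o Q); first exact: (measurableT_comp mg mQ).
  by apply/funext => z; rewrite /m upd_self.
exists (update_law cm gen_full lam m_other m_self).
apply: update_resampler; apply: agree_setU => // A C SA DC.
have [B mB AE] := (gen1P v A).1 SA.
rewrite /update_law /distribution /pushforward /=.
rewrite (_ : _ @^-1` _ = (C `*` setT) `&` Q @^-1` (g @^-1` B)).
  rewrite QE //; last by rewrite -[_ @^-1` _]setTI; exact: mg.
  by congr (pi _); rewrite AE setIC; congr (_ `&` _); apply/seteqP; split=> w /=; rewrite fK.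
rewrite AE; apply/seteqP; split=> z /=.
- rewrite /m upd_self => -[Bz Cz]; split => //; split => //.
  exact: (update_ext m_other z vpa DC).1 Cz.
- rewrite /m upd_self => -[[Cz _] Bz]; split => //.
  exact: (update_ext m_other z vpa DC).2 Cz.
Qed.

End ResamplerExistence.

(** * Directed graphs *)

Section NonDescendants.
Context (W : finType) (H : rel W) (rank : W -> nat).
Hypothesis rankH : forall u v, H u v -> (rank u < rank v)%N.

Definition nondesc (u : W) : {set W} := (~: (u |: descendants H u))%SET.

Lemma nondescE u v : (v \in nondesc u) = (v != u) && (v \notin descendants H u).
Proof. by rewrite finset.in_setC finset.in_setU1 negb_or. Qed.

Lemma descendantP u v :
  reflect (exists2 k, H u k & connect H k v) (v \in descendants H u).
Proof.
rewrite !finset.inE; apply: (iffP existsP) => [[k /andP[uk kv]]|[k uk kv]]; exists k => //.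
by rewrite uk.
Qed.

Lemma rank_connect u v : connect H u v -> (rank u <= rank v)%N.
Proof.
move=> /connectP[p + ->]; elim: p u => //= w p IH u /andP[uw /IH].
exact/leq_trans/ltnW/rankH.
Qed.

Lemma rank_descendant u v : v \in descendants H u -> (rank u < rank v)%N.
Proof. by move=> /descendantP[k /rankH uk /rank_connect]; exact: leq_trans. Qed.

Lemma lt_rank_nondesc u v : (rank v <= rank u)%N -> v != u -> v \in nondesc u.
Proof.
move=> vu neq; rewrite nondescE neq /=.
by apply/negP => /rank_descendant; rewrite ltnNge vu.
Qed.

Lemma self_nondesc u : u \notin nondesc u.
Proof. by rewrite nondescE eqxx. Qed.

Lemma parent_neq u v : H u v -> u != v.
Proof. by apply: contraTneq => -> ; apply/negP => /rankH; rewrite ltnn. Qed.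

Lemma parents_nondesc u : parents H u \subset nondesc u.
Proof.
apply/fintype.subsetP => v; rewrite finset.inE => vu.
exact: (lt_rank_nondesc (ltnW (rankH vu)) (parent_neq vu)).
Qed.

(** A child of [u] or of a descendant of [u] is a descendant of [u]. *)
Lemma nondesc_parents u v : v \in nondesc u -> parents H v \subset nondesc u.
Proof.
move=> vu; apply/fintype.subsetP => w; rewrite finset.inE => wv.
move: vu; rewrite !nondescE => /andP[_ /negP vu].
apply/andP; split; apply/negP.
- move=> /eqP wu; apply: vu.
  by apply/(descendantP u v); exists v; rewrite // -wu.
- move=> /(descendantP u w)[k uk kw]; apply: vu.
  apply/(descendantP u v); exists k => //.
  exact: connect_trans kw (connect1 wv).
Qed.

End NonDescendants.

Section AddVertex.
Context (W : finType) (H : rel W) (rank : W -> nat).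
Hypothesis rankH : forall u v, H u v -> (rank u < rank v)%N.
Context (T : W -> ptopologicalType).
Context d (Omega : measurableType d) (c : forall u, Omega -> T u).
Hypothesis cm : forall u, measurable_fun setT (c u : Omega -> borel (T u)).
Context (R : realType).
Implicit Types (D : {set W}) (P rho : probability Omega R).

(** Descendants are those of the whole graph. When [D] is closed under parents, every directed path
    ending in [D] stays in [D], so this is the local Markov property of the induced subgraph. *)
Definition local_markov rho D := forall u, u \in D ->
  markov c rho [set u]%SET (nondesc H u :&: D)%SET (parents H u).

(** For an old vertex [u] there are two cases. If [v] is not a descendant of [u], neither are its
    parents, and the draw uses only what is already independent of [u] given its parents. Otherwise
    [v] does not occur in the property of [u]. *)
Lemma local_markov_add pi rho v U D :
  resampler c v (parents H v) pi U -> v \notin D -> parents H v \subset D ->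
  (forall u, u \in D -> parents H u \subset D) ->
  local_markov rho D -> local_markov (U rho) (v |: D)%SET.
Proof.
move=> rU vD pvD pD M u; rewrite in_setU1 => /predU1P[->|uD].
  apply: (resample_markov_self cm _ rU); last first.
    by rewrite finset.in_setI (negbTE (self_nondesc _ _)).
  by rewrite finset.inE; apply/negP => /(parent_neq rankH); rewrite eqxx.
have uv : u != v by apply: contraTneq uD => ->.
have vu : v \notin [set u]%SET by rewrite finset.in_set1 eq_sym.
have vA : v \notin (nondesc H u :&: D)%SET by rewrite finset.in_setI (negbTE vD) andbF.
have vB : v \notin parents H u.
  by apply: contraNN vD; move: (pD u uD) => /fintype.subsetP; exact.
have [vnd|vnd] := boolP (v \in nondesc H u).
  rewrite (_ : (nondesc H u :&: (v |: D))%SET = (v |: (nondesc H u :&: D))%SET).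
    apply: (resample_markov rU) => //; last exact: M.
    by rewrite finset.subsetI (nondesc_parents vnd).
  apply/setP => w; rewrite finset.in_setI !in_setU1 finset.in_setI.
  by case: eqVneq => // ->; rewrite vnd.
rewrite (_ : (nondesc H u :&: (v |: D))%SET = (nondesc H u :&: D)%SET).
  apply: (markov_agree cm _ _ (M u uD)).
  - by rewrite finset.subsetI (parents_nondesc rankH) pD.
  - by apply/agree_sym/(resample_other rU); rewrite finset.in_setU negb_or vu.
apply/setP => w; rewrite !finset.in_setI in_setU1.
by case: eqVneq => // ->; rewrite (negbTE vnd).
Qed.

End AddVertex.

(** * Rearranging a coupling along the graph *)

Section Rearrangement.
Context (n : nat) (E : rel 'I_n).
Hypothesis E_lt : forall i j, E i j -> (i < j)%N.
Hypothesis E_clique : forall i j k, E j i -> E k i -> (j < k)%N -> E j k.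

Definition lev (u : 'I_n + 'I_n) : 'I_n := match u with inl i => i | inr i => i end.
Definition side (u : 'I_n + 'I_n) : bool := if u is inr _ then true else false.
Definition vtx (s : bool) (i : 'I_n) : 'I_n + 'I_n := if s then inr i else inl i.

Lemma lev_vtx s i : lev (vtx s i) = i. Proof. by case: s. Qed.
Lemma side_vtx s i : side (vtx s i) = s. Proof. by case: s. Qed.

Lemma vtx_eqE u s i : (u == vtx s i) = (side u == s) && (lev u == i).
Proof. by case: u s => [j|j] []. Qed.

(* [oriented false] is [causal_graph E]; [oriented true] is its mirror image, in
   which the copies i' come first. *)
Definition oriented (s : bool) : rel ('I_n + 'I_n) := fun u v =>
  E (lev u) (lev v) && ((side u == s) || (side v != s))
  || (lev u == lev v) && ((side u == s) && (side v != s)).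

(** A topological order for [oriented s]: by level, and within a level the vertex of side [s]
    first. *)
Definition orank (s : bool) (u : 'I_n + 'I_n) : nat := (lev u).*2 + (side u != s).

Lemma orank_lt s u v : oriented s u v -> (orank s u < orank s v)%N.
Proof.
rewrite /orank => /orP[/andP[/E_lt uv _]|/andP[/eqP <- /andP[/eqP -> ->]]].
  apply: leq_trans (leq_addr _ _); apply: leq_trans (_ : (lev u).+1.*2 <= _)%N.
    by rewrite doubleS ltnS -addn1 leq_add2l; case: (_ != _).
  by rewrite leq_double.
by rewrite eqxx addn0 addn1.
Qed.

Definition below_level k : {set 'I_n + 'I_n} := [set u | (lev u < k)%N]%SET.
Definition side_below s k : {set 'I_n + 'I_n} :=
  [set u | (side u == s) && (lev u < k)%N]%SET.
Definition level i : {set 'I_n + 'I_n} := [set u | lev u == i]%SET.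
Definition pair_parents i : {set 'I_n + 'I_n} := [set u | E (lev u) i]%SET.
Definition side_parents s i : {set 'I_n + 'I_n} :=
  [set u | (side u == s) && E (lev u) i]%SET.
Definition family i : {set 'I_n + 'I_n} := (level i :|: pair_parents i)%SET.

Lemma parents_first s i : parents (oriented s) (vtx s i) = side_parents s i.
Proof.
apply/setP => u; rewrite !finset.inE /oriented lev_vtx side_vtx eqxx orbF !andbF orbF.
exact: andbC.
Qed.

Lemma parents_second s i :
  parents (oriented s) (vtx (~~ s) i) = (vtx s i |: pair_parents i)%SET.
Proof.
apply/setP => u; rewrite !finset.inE /oriented lev_vtx side_vtx vtx_eqE.
have -> : (~~ s != s) by case: s.
by rewrite orbT !andbT orbC [_ && (lev u == i)]andbC.
Qed.

Lemma level_vtx s i : level i = [set vtx s i; vtx (~~ s) i]%SET.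
Proof.
by apply/setP => u; rewrite !finset.inE !vtx_eqE; case: (side u) s => [] []; rewrite /= ?orbF.
Qed.

Lemma below_levelS s (i : 'I_n) :
  below_level i.+1 = (vtx (~~ s) i |: (vtx s i |: below_level i))%SET.
Proof.
rewrite finset.setUA [(_ |: [set _])%SET]finset.setUC -[([set _] :|: _)%SET]/[set _; _]%SET -level_vtx.
by apply/setP => u; rewrite !finset.inE ltnS leq_eqVlt.
Qed.

Lemma below_level_union (i : 'I_n) : below_level i.+1 = (level i :|: below_level i)%SET.
Proof. by apply/setP => u; rewrite !finset.inE ltnS leq_eqVlt. Qed.

Lemma side_belowS s (i : 'I_n) : side_below s i.+1 = (vtx s i |: side_below s i)%SET.
Proof.
by apply/setP => u; rewrite !finset.inE vtx_eqE ltnS leq_eqVlt -andb_orr.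
Qed.

Lemma vtx_notin_below s (i : 'I_n) : vtx s i \notin below_level i.
Proof. by rewrite !finset.inE lev_vtx ltnn. Qed.

Lemma pair_parents_below (i : 'I_n) : pair_parents i \subset below_level i.
Proof. by apply/fintype.subsetP => u; rewrite !finset.inE; exact: E_lt. Qed.

Lemma side_parents_pair s (i : 'I_n) : side_parents s i \subset pair_parents i.
Proof. by apply/fintype.subsetP => u; rewrite !finset.inE => /andP[]. Qed.

Lemma side_parents_side s (i : 'I_n) : side_parents s i \subset side_below s i.
Proof. by apply/fintype.subsetP => u; rewrite !finset.inE => /andP[-> /E_lt]. Qed.

Lemma side_below_below s k : side_below s k \subset below_level k.
Proof. by apply/fintype.subsetP => u; rewrite !finset.inE => /andP[]. Qed.

Lemma family_below (j i : 'I_n) : (j < i)%N -> family j \subset below_level i.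
Proof.
move=> ji; apply/fintype.subsetP => u; rewrite !finset.inE => /orP[/eqP -> //|/E_lt uj].
exact: ltn_trans ji.
Qed.

Lemma oriented_below s k u : u \in below_level k ->
  parents (oriented s) u \subset below_level k.
Proof.
rewrite !finset.inE => uk; apply/fintype.subsetP => v; rewrite !finset.inE.
move=> /orP[/andP[/E_lt vu _]|/andP[/eqP -> _] //]; exact: ltn_trans uk.
Qed.

(* The only use of perfectness, in the form [E_clique]. *)
Lemma pair_parents_family i : pair_parents i = finset.set0 \/
  exists2 j : 'I_n, (j < i)%N & pair_parents i \subset family j.
Proof.
have [j0 j0i|noE] := pickP (fun j => E j i); last first.
  by left; apply/setP => u; rewrite !finset.inE noE.
right; case: (@arg_maxnP _ j0 (fun j => E j i) (fun j => val j) j0i) => j ji jmax.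
exists j; first exact: E_lt.
apply/fintype.subsetP => u; rewrite !finset.inE => ui.
have : (lev u <= j)%N by exact: jmax.
rewrite leq_eqVlt => /predU1P[/val_inj ->|uj]; first by rewrite eqxx.
by rewrite (E_clique ui ji uj) orbT.
Qed.

Context (T : 'I_n + 'I_n -> ptopologicalType).
Context d (Omega : measurableType d) (c : forall u, Omega -> T u).
Hypothesis cm : forall u, measurable_fun setT (c u : Omega -> borel (T u)).
Hypothesis gen_full : measurable `<=` <<s gen c (finset.setT) >>.
Context (R : realType).
Variable upd : forall u, Omega -> T u -> Omega.
Hypothesis upd_self : forall u w t, c u (@upd u w t) = t.
Hypothesis upd_other : forall u v w t, u != v -> c u (@upd v w t) = c u w.
Hypothesis codes : forall u, borel_code R (T u).
Variable pi : probability Omega R.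
(** All that the rearrangement uses of [pi]: it summarises bicausality for the complete graph and
    compatibility of both marginals. *)
Hypothesis pi_markov : forall s i,
  markov c pi [set vtx s i]%SET (below_level i) (side_parents s i).
Implicit Types rho : probability Omega R.

Definition rearranged_side s k rho :=
  agree c (side_below s k) rho pi /\ local_markov (oriented s) c rho (below_level k).

(** The invariant after [k] levels. It says nothing of the coordinates of level [k] and above, which
    are still to be overwritten. *)
Definition rearranged k rho :=
  (forall j : 'I_n, (j < k)%N -> agree c (family j) rho pi) /\
  (forall s, rearranged_side s k rho).

Lemma rearranged_pair_parents (i : 'I_n) rho : rearranged i rho ->
  agree c (pair_parents i) rho pi.
Proof.
move=> [fam _]; have [->|[j ji sub]] := pair_parents_family i; first exact: agree0.
exact: agreeS sub (fam j ji).
Qed.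

(** The last clause serves to compare the two values of [s]: with the first two it determines the
    law of all pairs up to level [i]. *)
Lemma rearrange_step s (i : 'I_n) rho : rearranged i rho -> exists rho',
  [/\ agree c (below_level i) rho' rho, agree c (family i) rho' pi,
      rearranged_side s i.+1 rho' &
      markov c rho' (level i) (below_level i) (pair_parents i)].
Proof.
move=> inv; have [_ /(_ s)[side_pi M]] := inv.
have pp := rearranged_pair_parents inv.
set a := vtx s i; set b := vtx (~~ s) i.
have ab : a != b by rewrite vtx_eqE side_vtx; case: (s).
have aD : a \notin below_level i by exact: vtx_notin_below.
have bD : b \notin below_level i by exact: vtx_notin_below.
have notpp v : v \notin below_level i -> v \notin pair_parents i.
  by apply: contraNN; move/fintype.subsetP: (pair_parents_below i); exact.
have apa : a \notin parents (oriented s) a.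
  by rewrite finset.inE; apply/negP => /(parent_neq (@orank_lt s)); rewrite eqxx.
have bpb : b \notin parents (oriented s) b.
  by rewrite finset.inE; apply/negP => /(parent_neq (@orank_lt s)); rewrite eqxx.
have [Ua rUa] := resampler_exists cm gen_full upd_self upd_other pi (codes a) apa.
have [Ub rUb] := resampler_exists cm gen_full upd_self upd_other pi (codes b) bpb.
have baD : b \notin (a |: below_level i)%SET by rewrite in_setU1 negb_or eq_sym ab.
exists (Ub (Ua rho)); split.
- exact: agree_trans (resample_other rUb _ bD) (resample_other rUa _ aD).
- have Hb := resample_agree rUb (rho := Ua rho) (rho' := pi) (subxx _).
  rewrite /family (level_vtx s) -/a -/b.
  rewrite (_ : [set a; b] :|: pair_parents i = b |: (a |: pair_parents i))%SET; last first.
    by rewrite finset.setUCA finset.setUA.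
  have bE : parents (oriented s) b = (a |: pair_parents i)%SET := parents_second s i.
  rewrite -bE; apply: agree_trans (resample_fix rUb); apply: Hb; rewrite bE.
  apply: (agree_trans (P2 := Ua pi)).
    apply: (resample_agree rUa) => //.
    by rewrite parents_first; exact: side_parents_pair.
  (* [a] is drawn given the parents on its own side only; under [pi] this is the same as drawing it
     given all parent pairs. *)
  apply: (resample_fix_ext cm apa rUa); first exact: notpp.
    by rewrite parents_first; exact: side_parents_pair.
  rewrite parents_first; apply: (markovS _ _ _ (@pi_markov s i)) => //.
  exact: pair_parents_below.
- split.
  (* The draw of [b] does not touch side [s], and that of [a] reproduces the marginal of [pi]
     there. *)
  + apply: (agree_trans (P2 := Ua rho)).
      apply: (resample_other rUb).
      by rewrite finset.inE side_vtx; case: (s).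
    rewrite side_belowS -/a; apply: (agree_trans (P2 := Ua pi)).
      apply: (resample_agree rUa) => //.
      by rewrite parents_first; exact: side_parents_side.
    apply: (resample_fix_ext cm apa rUa).
    * by rewrite finset.inE lev_vtx ltnn andbF.
    * by rewrite parents_first; exact: side_parents_side.
    * rewrite parents_first; apply: (markovS _ _ _ (@pi_markov s i)) => //.
      exact: side_below_below.
  + rewrite (below_levelS s) -/a -/b.
    have Ma : local_markov (oriented s) c (Ua rho) (a |: below_level i)%SET.
      apply: (local_markov_add (@orank_lt s) cm rUa) => //.
      * rewrite parents_first; apply: fintype.subset_trans (pair_parents_below i).
        exact: side_parents_pair.
      * by move=> u; exact: oriented_below.
    apply: (local_markov_add (@orank_lt s) cm rUb) => //.
    * rewrite parents_second; apply: finset.setUS; exact: pair_parents_below.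
    * move=> u; rewrite in_setU1 => /predU1P[->|/oriented_below sub].
        rewrite parents_first; apply: fintype.subset_trans (finset.subsetUr _ _).
        by apply: fintype.subset_trans (pair_parents_below i); exact: side_parents_pair.
      exact: fintype.subset_trans (sub s) (finset.subsetUr _ _).
- rewrite (level_vtx s).
  apply: (two_step_markov cm _ rUa rUb) => //.
  + by rewrite parents_first; exact: side_parents_pair.
  + by rewrite parents_second.
  + exact: notpp.
  + exact: notpp.
Qed.

Lemma rearranged_exists k : (k <= n)%N -> exists rho, rearranged k rho.
Proof.
elim: k => [_|k IH kn].
  exists pi; split => // s; split => // u.
  by rewrite finset.inE ltn0.
have [rho inv] := IH (ltnW kn).
pose i := Ordinal kn; rewrite -[k]/(val i) in inv *.
have [rhoF [F1 F2 [F3 F4] F5]] := rearrange_step false inv.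
have [rhoT [T1 T2 [T3 T4] T5]] := rearrange_step true inv.
(* Both orders start from the same [rho], so by uniqueness they end with the same law up to level
   [i]. *)
have eqFT : agree c (below_level i.+1) rhoT rhoF.
  rewrite below_level_union; apply: (agree_markov cm _ T5 F5).
  - exact: pair_parents_below.
  - exact: agree_trans T1 (agree_sym F1).
  - exact: agree_trans T2 (agree_sym F2).
exists rhoF; split.
- move=> j; rewrite ltnS leq_eqVlt => /predU1P[/val_inj -> //|ji].
  apply: agree_trans (inv.1 j ji); apply: agreeS F1.
  exact: family_below.
(* The properties for side [true] are those of [rhoT], carried over to [rhoF] along this
   agreement. *)
- case; last by split; [exact: F3|exact: F4].
  split.
  + apply: agree_trans T3; apply: agree_sym; apply: agreeS eqFT.
    exact: side_below_below.
  + move=> u uD; apply: (markov_agree cm _ _ (T4 u uD)).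
    * rewrite finset.subsetI (parents_nondesc (@orank_lt true)).
      exact: oriented_below.
    * apply: agreeS eqFT; rewrite finset.subUset finset.sub1set uD.
      exact: finset.subsetIr.
Qed.

Lemma rearrangement : exists rho,
  [/\ forall i, agree c (level i) rho pi,
      forall s, agree c [set u | side u == s]%SET rho pi &
      forall s u, markov c rho [set u]%SET (nondesc (oriented s) u) (parents (oriented s) u)].
Proof.
have [rho [fam inv]] := rearranged_exists (leqnn n); exists rho.
have allT : below_level n = finset.setT by apply/setP => u; rewrite !finset.inE ltn_ord.
split => [i|s|s u].
- by apply: agreeS (fam i (ltn_ord i)); exact: finset.subsetUl.
- apply: agreeS (inv s).1; apply/fintype.subsetP => u; rewrite !finset.inE => ->.
  exact: ltn_ord.
- have := (inv s).2 u; rewrite allT finset.setIT; apply.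
  by rewrite finset.inE.
Qed.

End Rearrangement.

(** * Borel sets of finite products *)

Section CountableBase.

Definition countable_base (T : topologicalType) := exists B : nat -> set T,
  (forall k, open (B k)) /\
  forall x U, nbhs x U -> exists k, B k x /\ B k `<=` U.

Lemma separable_countable_base (R : realType) (X : pmetricType R) :
  separable X -> countable_base X.
Proof.
move=> sX; have [s sD] := dense_seq sX.
pose B j := if unpickle j is Some mk then [set z : X | mdist (s mk.1) z < mk.2.+1%:R^-1]
  else set0.
exists B; split=> [j|x U].
  by rewrite /B; case: (unpickle j) => [mk|]; [exact: open_mdist_lt|exact: open0].
rewrite -nbhs_ballE => -[e /= e0]; rewrite ballEmdist => eU.
have e20 : 0 < e / 2 by rewrite divr_gt0.
have [k ke] := invn_lt e20.
have [||m /= xm] := sD [set z : X | mdist x z < k.+1%:R^-1].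
- exact: open_mdist_lt.
- by exists x => /=; rewrite mdistxx invr_gt0.
exists (pickle (m, k)); rewrite /B pickleK /= metric_sym; split => // z /= mz.
apply: eU => /=; apply: le_lt_trans (metric_triangle _ (s m) _) _.
by rewrite [e]splitr ltrD // (lt_trans _ ke).
Qed.

(** The sets containing a box around [w] form a filter, and its convergence to [w] can be checked
    one coordinate at a time. Boxes may constrain every coordinate, so finiteness of supports never
    enters. *)
Lemma product_nbhs_box (I : Type) (T : I -> ptopologicalType) (w : product_space T) O :
  nbhs w O -> exists U : forall i, set (T i),
    (forall i, nbhs (w i) (U i)) /\ forall w', (forall i, U i (w' i)) -> O w'.
Proof.
pose F : set_system (product_space T) := [set O | exists U : forall i, set (T i),
    (forall i, nbhs (w i) (U i)) /\ forall w', (forall i, U i (w' i)) -> O w'].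
have FF : Filter F.
  split.
  - by exists (fun=> setT); split => // i; exact: filterT.
  - move=> P Q [U [nU UP]] [V [nV VQ]]; exists (fun i => U i `&` V i); split.
      by move=> i; exact: filterI.
    by move=> w' H; split; [apply: UP|apply: VQ] => i; case: (H i).
  - move=> P Q PQ [U [nU UP]]; exists U; split => // w' /UP; exact: PQ.
suff Fw : F --> w by move=> /Fw.
apply/cvg_sup => i A [_ [[V oV <-] Vw] VA].
have nV : nbhs (w i) V by apply: open_nbhs_nbhs.
(* The index type has no decidable equality: quantifying over proofs of [i = j] gives [V] at [i] and
   no constraint elsewhere. *)
exists (fun j => [set z | forall e : i = j, V (eq_rect_r (fun k => T k) z e)]); split.
  move=> j; have [ij|nij] := pselect (i = j).
    case: j / ij; apply: filterS nV => z Vz e'.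
    by rewrite (Prop_irrelevance e' erefl).
  by apply: nearW => z /= e'; case: (nij e').
by move=> w' H; apply: VA; exact: (H i erefl).
Qed.

Context d (S : measurableType d).

Lemma measurable_into_borel (T : ptopologicalType) (f : S -> T) :
  (forall O, open O -> measurable (f @^-1` O)) -> measurable_fun setT (f : S -> borel T).
Proof.
move=> mf; apply: (@measurability _ _ S (borel T) setT f (@open T)) => //.
by move=> _ [Z oZ <-]; rewrite setTI; exact: mf.
Qed.

Lemma measurable_box (I : finType) (T : I -> ptopologicalType) (f : S -> product_space T)
    (B : forall i, nat -> set (T i)) (b : {ffun I -> nat}) :
  (forall i k, open (B i k)) ->
  (forall i, measurable_fun setT ((fun s => f s i) : S -> borel (T i))) ->
  measurable [set s | forall i, B i (b i) (f s i)].
Proof.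
move=> oB mf.
rewrite (_ : [set s | _] = \bigcap_i ((fun s => f s i) @^-1` B i (b i))); last first.
  by apply/seteqP; split=> [s H i _|s H i]; [exact: H|exact: (H i Logic.I)].
apply: fin_bigcap_measurable => [|i _]; first exact: finite_finset.
rewrite -[_ @^-1` _]setTI.
by apply: mf => //; exact: sub_sigma_algebra.
Qed.

(** For a finite index set the boxes of basic open sets are countably many, and every open set is
    the union of those it contains. *)
Lemma measurable_into_product (I : finType) (T : I -> ptopologicalType)
    (f : S -> product_space T) : (forall i, countable_base (T i)) ->
  (forall i, measurable_fun setT ((fun s => f s i) : S -> borel (T i))) ->
  measurable_fun setT (f : S -> borel (product_space T)).
Proof.
move=> cb mf; pose B i := sval (cid (cb i)).
have oB i k : open (B i k) by exact: (svalP (cid (cb i))).1.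
have bB i x U : nbhs x U -> exists k, B i k x /\ B i k `<=` U.
  exact: (svalP (cid (cb i))).2.
apply: measurable_into_borel => O opO.
pose box (b : {ffun I -> nat}) : set (product_space T) := [set w | forall i, B i (b i) (w i)].
rewrite (_ : f @^-1` O = \bigcup_k (if unpickle k is Some b then
    if `[< box b `<=` O >] then f @^-1` box b else set0 else set0)).
  apply: bigcupT_measurable => k; case: (unpickle k) => [b|] //.
  by case: ifP => // _; exact: measurable_box.
apply/seteqP; split=> s /=.
- move=> Ofs; have nO : nbhs (f s) O by exact: open_nbhs_nbhs.
  have [U [nU UO]] := product_nbhs_box nO.
  have [b bP] := choice (fun i => bB i _ _ (nU i)).
  exists (pickle [ffun i => b i]) => //; rewrite pickleK ifT.
    by move=> i; rewrite ffunE; case: (bP i).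
  apply/asboolP => w Hw; apply: UO => i; apply: (bP i).2.
  by have := Hw i; rewrite ffunE.
- by move=> [k _]; case: (unpickle k) => // b; case: ifP => // /asboolP; apply.
Qed.

Lemma measurable_into_pair (I : finType) (X Y : I -> ptopologicalType)
    (f : S -> pair_space X Y) : (forall i, countable_base (X i)) ->
  (forall i, countable_base (Y i)) ->
  (forall i, measurable_fun setT ((fun s => (f s).1 i) : S -> borel (X i))) ->
  (forall i, measurable_fun setT ((fun s => (f s).2 i) : S -> borel (Y i))) ->
  measurable_fun setT (f : S -> borel (pair_space X Y)).
Proof.
move=> cX cY mX mY; pose B i := sval (cid (cX i)); pose C i := sval (cid (cY i)).
have oB i k : open (B i k) by exact: (svalP (cid (cX i))).1.
have bB i x U : nbhs x U -> exists k, B i k x /\ B i k `<=` U.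
  exact: (svalP (cid (cX i))).2.
have oC i k : open (C i k) by exact: (svalP (cid (cY i))).1.
have bC i x U : nbhs x U -> exists k, C i k x /\ C i k `<=` U.
  exact: (svalP (cid (cY i))).2.
apply: measurable_into_borel => O opO.
pose boxX (b : {ffun I -> nat}) : set S := [set s | forall i, B i (b i) ((f s).1 i)].
pose boxY (b : {ffun I -> nat}) : set S := [set s | forall i, C i (b i) ((f s).2 i)].
pose good (b b' : {ffun I -> nat}) := forall z : pair_space X Y,
  (forall i, B i (b i) (z.1 i)) -> (forall i, C i (b' i) (z.2 i)) -> O z.
rewrite (_ : f @^-1` O = \bigcup_k (if (unpickle k : option ({ffun I -> nat} * {ffun I -> nat})) is Some b then
    if `[< good b.1 b.2 >] then boxX b.1 `&` boxY b.2 else set0 else set0)).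
  apply: bigcupT_measurable => k; case: (unpickle k) => [b|] //.
  case: ifP => // _; apply: measurableI.
  - exact: (measurable_box (f := fun s => (f s).1)).
  - exact: (measurable_box (f := fun s => (f s).2)).
apply/seteqP; split=> s /=.
- move=> Ofs; have [[P Q] /= [nP nQ] PQ] : nbhs (f s) O by exact: open_nbhs_nbhs.
  have [U [nU UP]] := product_nbhs_box nP.
  have [V [nV VQ]] := product_nbhs_box nQ.
  have [b bP] := choice (fun i => bB i _ _ (nU i)).
  have [b' bP'] := choice (fun i => bC i _ _ (nV i)).
  exists (pickle ([ffun i => b i], [ffun i => b' i])) => //; rewrite pickleK ifT.
    by split=> i; rewrite ffunE; [case: (bP i)|case: (bP' i)].
  apply/asboolP => z Hz Hz'; apply: PQ; split => /=.
  + by apply: UP => i; apply: (bP i).2; have := Hz i; rewrite ffunE.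
  + by apply: VQ => i; apply: (bP' i).2; have := Hz' i; rewrite ffunE.
- move=> [k _]; case: (unpickle k) => // b; case: ifP => // /asboolP H [H1 H2].
  exact: H.
Qed.

End CountableBase.

(** * Compatibility as a local Markov property *)

Section Compatibility.
Context (V : finType) (T : V -> ptopologicalType).
Context d (Omega : measurableType d) (c : forall u, Omega -> T u).
Hypothesis cm : forall u, measurable_fun setT (c u : Omega -> borel (T u)).
Hypothesis cbT : forall u, countable_base (T u).
Context (R : realType).

Lemma sigma_ofE (U : ptopologicalType) (f : Omega -> U) A :
  sigma_of f A <-> exists2 B : set (borel U), measurable B & A = f @^-1` B.
Proof. by split=> -[B mB]; [move=> <-; rewrite setTI|move=> ->; rewrite -[_ @^-1` _]setTI]; exists B. Qed.

Lemma sigma_of_coord u : sigma_of (c u) = <<s gen c [set u]%SET >>.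
Proof.
apply/seteqP; split=> A; first by move=> /sigma_ofE H; apply/gen1P.
by move=> /gen1P H; apply/sigma_ofE.
Qed.

Lemma continuous_coordinate (I : eqType) (U : I -> ptopologicalType) i :
  continuous ((fun w => w i) : product_space U -> U i).
Proof. exact: (@proj_continuous I U i). Qed.

(** Coordinates are continuous, which gives one inclusion; the countable bases give the other, that
    a Borel set of the subproduct is an event in the coordinates. *)
Lemma sigma_of_restrict (A : {set V}) :
  sigma_of (restrict_to c (A:=A)) = <<s gen c A >>.
Proof.
apply/seteqP; split=> Z.
- move=> /sigma_ofE[B mB ->].
  have mr : measurable_fun setT
      (restrict_to c (A:=A) : g_sigma_algebraType (gen c A) -> borel (subproduct A)).
    apply: measurable_into_product => [i|i]; first exact: cbT.
    by move=> _ D mD; rewrite setTI; apply: gen_coord => //; exact: (valP i).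
  by rewrite -[_ @^-1` _]setTI; exact: mr.
- move: Z; apply: smallest_sub.
    by apply: sigma_algebra_preimage; exact: sigma_algebra_measurable.
  move=> _ [u uA [B mB ->]]; apply/sigma_ofE.
  exists ((fun w : subproduct A => w (exist _ u uA)) @^-1` B) => //.
  have := continuous_borel (@continuous_coordinate _ (fun i : {i | i \in A} => T (val i)) (exist _ u uA)).
  by move=> /(_ measurableT B mB); rewrite setTI.
Qed.

Variables (H : rel V) (rank : V -> nat).
Hypothesis rankH : forall u v, H u v -> (rank u < rank v)%N.

Lemma compatible_markov (P : probability Omega R) : compatible H P c <->
  forall u, markov c P [set u]%SET (nondesc H u) (parents H u).
Proof.
have Gm := gen_measurable cm.
have E u : cond_indep P (sigma_of (c u))
    (sigma_of (restrict_to c (A:=(~: (u |: descendants H u))%SET)))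
    (sigma_of (restrict_to c (A:=parents H u))) <->
    markov c P [set u]%SET (nondesc H u) (parents H u).
  rewrite sigma_of_coord !sigma_of_restrict.
  apply: cond_indep_markov => //; apply: genS; exact: (parents_nondesc rankH).
by split=> HH u; apply/E; exact: HH.
Qed.

End Compatibility.

(** * Contraction and pullback of Markov properties *)

Section Transport.
Context (R : realType).

(** The contraction property: the versions given [M] and given [B] have the same integrals over
    events in [M], hence are equal almost everywhere. *)
Lemma markov_trans (W : finType) (T : W -> ptopologicalType) d
    (Omega : measurableType d) (c : forall u, Omega -> T u)
    (cm : forall u, measurable_fun setT (c u : Omega -> borel (T u)))
    (P : probability Omega R) (S D M B : {set W}) : B \subset M -> M \subset D ->
  markov c P S D M -> markov c P S M B -> markov c P S D B.
Proof.
move=> BM MD M1 M2 A SA; have Gm := gen_measurable cm.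
have [g1 [mg1 b1 E1]] := M1 A SA; have [g2 [mg2 b2 E2]] := M2 A SA.
have mg2' : sub_measurable (gen c M) g2 by exact: sub_measurableS (genS BM) mg2.
exists g2; split => // C DC; rewrite -E1 //; apply/esym.
have mG (g : Omega -> R) : sub_measurable (gen c M) g -> measurable_fun setT (EFin \o g).
  by move=> mg; apply/measurable_EFinP; exact: (measurable_of_sub (@Gm _) mg).
apply: ae_eq_integral => //.
- exact: (gsub_measurable (@Gm _) DC).
- exact: measurable_funTS (mG _ mg1).
- exact: measurable_funTS (mG _ mg2').
apply: ae_eq_subset (_ : C `<=` setT) _ => //.
apply: (version_ae_eq (@Gm M)) => // C' MC'.
by rewrite E1 ?E2 //; exact: (genS MD).
Qed.

Context (V W : finType) (e : V -> W).
Context (T : V -> ptopologicalType) (U : W -> ptopologicalType).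
Context d d' (Omega : measurableType d) (Omega' : measurableType d').
Variables (c' : forall u, Omega' -> T u) (c : forall u, Omega -> U u).
Hypothesis cm' : forall u, measurable_fun setT (c' u : Omega' -> borel (T u)).
Hypothesis cm : forall u, measurable_fun setT (c u : Omega -> borel (U u)).
Variables (P' : probability Omega' R) (P : probability Omega R) (phi : Omega -> Omega').
Hypothesis mphi : measurable_fun setT phi.
Hypothesis PP' : forall A, measurable A -> P' A = P (phi @^-1` A).
Hypothesis fwd : forall u (B : set (borel (T u))), measurable B ->
  exists2 B' : set (borel (U (e u))), measurable B' &
    phi @^-1` (c' u @^-1` B) = c (e u) @^-1` B'.
Hypothesis bwd : forall u (B : set (borel (U (e u)))), measurable B ->
  exists2 B' : set (borel (T u)), measurable B' &
    c (e u) @^-1` B = phi @^-1` (c' u @^-1` B').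

Lemma gen_fwd (S : {set V}) A : <<s gen c' S >> A -> <<s gen c (e @: S)%SET >> (phi @^-1` A).
Proof.
move: A.
suff : <<s gen c' S >> `<=` [set A | <<s gen c (e @: S)%SET >> (setT `&` phi @^-1` A)].
  by move=> H A /H /=; rewrite setTI.
apply: smallest_sub.
  apply: (@sigma_algebra_image _ _ setT phi <<s gen c (e @: S)%SET >>).
  exact: smallest_sigma_algebra.
move=> _ [u uS [B mB ->]] /=; rewrite setTI; have [B' mB' ->] := fwd mB.
by apply: gen_coord => //; exact: imset_f.
Qed.

Lemma gen_bwd (S : {set V}) A : <<s gen c (e @: S)%SET >> A ->
  exists2 A', <<s gen c' S >> A' & A = phi @^-1` A'.
Proof.
move: A.
suff : <<s gen c (e @: S)%SET >> `<=` preimage_set_system setT phi <<s gen c' S >>.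
  by move=> H A /H [A' SA']; rewrite setTI => <-; exists A'.
apply: smallest_sub.
  by apply: sigma_algebra_preimage; exact: smallest_sigma_algebra.
move=> _ [u /imsetP[v vS uv] [B mB ->]]; move: B mB; rewrite uv => B mB.
have [B' mB' ->] := bwd mB; exists (c' v @^-1` B'); rewrite ?setTI //.
exact: gen_coord.
Qed.

(** Composing a version with [phi] gives a version. Coordinate spaces are matched through their
    events only, since [T u] and [U (e u)] need not be convertible for a variable [u]. *)
Lemma markov_pullback S D B : markov c' P' S D B ->
  markov c P (e @: S)%SET (e @: D)%SET (e @: B)%SET.
Proof.
move=> M A /gen_bwd[A' SA' ->]; have [g [mg g01 gE]] := M A' SA'.
have Gm' := gen_measurable cm'.
exists (g \o phi); split => //.
- move=> _ Z mZ; rewrite setTI comp_preimage; apply: gen_fwd.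
  by rewrite -[_ @^-1` _]setTI; exact: mg.
- by move=> w; exact: g01.
- move=> C /gen_bwd[C' DC' ->].
  have mC' := gsub_measurable (@Gm' _) DC'; have mA' := gsub_measurable (@Gm' _) SA'.
  rewrite -preimage_setI -PP'; last exact: measurableI.
  rewrite -gE //.
  transitivity (\int[pushforward P phi]_(w in C') (g w)%:E)%E.
    rewrite ge0_integral_pushforward //.
    + apply/measurable_funTS/measurable_EFinP; exact: (measurable_of_sub (@Gm' _) mg).
    + by move=> w _; rewrite lee_fin; case/andP: (g01 w).
  by apply: eq_measure_integral => Z mZ _; exact/esym/PP'.
Qed.

End Transport.

(** * Couplings on the pair space *)

Section PairSpace.
Context (R : realType) (n : nat) (X : 'I_n -> pmetricType R).
Hypothesis X_polish : forall i, polish (X i).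

Local Notation Omega := (borel (pair_space X X)).
Local Notation T := (pair_family X X).
Local Notation c := (@pair_coordinate _ X X : forall u, Omega -> T u).

Definition swap_vtx (u : 'I_n + 'I_n) : 'I_n + 'I_n :=
  match u with inl i => inr i | inr i => inl i end.

Lemma swap_vtxK : involutive swap_vtx. Proof. by case. Qed.

Lemma in_swap_vtx (A : {set 'I_n + 'I_n}) u : (u \in (swap_vtx @: A)%SET) = (swap_vtx u \in A).
Proof. by rewrite (can_imset_pre _ swap_vtxK) finset.inE. Qed.

Lemma base_coordinate i : countable_base (X i).
Proof. by apply: separable_countable_base; case: (X_polish i). Qed.

Lemma base_pair_family u : countable_base (T u).
Proof. by case: u => i; exact: base_coordinate. Qed.

Lemma measurable_pair_coordinate u : measurable_fun setT (c u : Omega -> borel (T u)).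
Proof.
apply: (@continuous_borel (pair_space X X) (T u)); case: u => i z.
- apply: (@continuous_comp _ _ _ fst (fun w : path_space X => w i)).
    exact: cvg_fst.
  exact: (@continuous_coordinate _ X).
- apply: (@continuous_comp _ _ _ snd (fun w : path_space X => w i)).
    exact: cvg_snd.
  exact: (@continuous_coordinate _ X).
Qed.

Lemma measurable_path_coordinate i :
  measurable_fun setT (@coordinate _ X i : borel (path_space X) -> borel (X i)).
Proof.
apply: (@continuous_borel (path_space X) (X i)) => w.
exact: (@continuous_coordinate _ X).
Qed.

Lemma pair_space_gen : @measurable _ Omega `<=` <<s gen c finset.setT >>.
Proof.
have cX i : countable_base (X i) := base_coordinate i.
have mid : measurable_fun setT
    (id : g_sigma_algebraType (gen c finset.setT) -> Omega).
  apply: measurable_into_pair => // i _ B mB; rewrite setTI.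
  - exact: (@gen_coord _ T _ Omega c finset.setT (inl i) B (finset.in_setT _) mB).
  - exact: (@gen_coord _ T _ Omega c finset.setT (inr i) B (finset.in_setT _) mB).
by move=> A mA; have := mid measurableT A mA; rewrite setTI.
Qed.

Lemma fst_gen A : measurable (A : set (borel (path_space X))) ->
  <<s gen c [set u | side u == false]%SET >> (fst @^-1` A).
Proof.
move=> mA.
have mf : measurable_fun setT ((fun z => z.1) :
    g_sigma_algebraType (gen c [set u | side u == false]%SET) -> borel (path_space X)).
  apply: measurable_into_product => [i|i _ B mB]; first exact: base_coordinate.
  rewrite setTI; apply: (@gen_coord _ T _ Omega c _ (inl i) B) => //.
  by rewrite finset.inE.
by have := mf measurableT A mA; rewrite setTI.
Qed.

Lemma snd_gen A : measurable (A : set (borel (path_space X))) ->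
  <<s gen c [set u | side u == true]%SET >> (snd @^-1` A).
Proof.
move=> mA.
have mf : measurable_fun setT ((fun z => z.2) :
    g_sigma_algebraType (gen c [set u | side u == true]%SET) -> borel (path_space X)).
  apply: measurable_into_product => [i|i _ B mB]; first exact: base_coordinate.
  rewrite setTI; apply: (@gen_coord _ T _ Omega c _ (inr i) B) => //.
  by rewrite finset.inE.
by have := mf measurableT A mA; rewrite setTI.
Qed.

Definition pair_update u (z : Omega) : T u -> Omega :=
  match u with
  | inl i => fun t => (dfwith z.1 i t, z.2)
  | inr i => fun t => (z.1, dfwith z.2 i t)
  end.

Lemma pair_update_self u z t : c u (@pair_update u z t) = t.
Proof. by case: u t => i t /=; rewrite dfwithin. Qed.

Lemma pair_update_other u v z t : u != v -> c u (@pair_update v z t) = c u z.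
Proof.
case: u v t => i [] j t //= ij; rewrite dfwithout //.
- by apply: contraNneq ij => ->.
- by apply: contraNneq ij => ->.
Qed.

Lemma pair_codes u : borel_code R (T u).
Proof. by case: u => i; exact: polish_borel_code. Qed.

Lemma oriented_causal_graph (E : rel 'I_n) : oriented E false = causal_graph E.
Proof.
apply/funext => -[i|i]; apply/funext => -[j|j]; rewrite /oriented /causal_graph /=;
  by rewrite ?andbT ?andbF ?orbF.
Qed.

Section Swap.
Variable P : probability Omega R.

Definition swapped : probability Omega R := distribution P (@swap_paths _ X X).

Lemma markov_unswap S D B : markov c swapped S D B ->
  markov c P (swap_vtx @: S)%SET (swap_vtx @: D)%SET (swap_vtx @: B)%SET.
Proof.
apply: (markov_pullback measurable_pair_coordinate
  (@measurable_swap_paths _ X X) _ _ _) => // -[i|i] B' mB'; exists B' => //.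
Qed.

Lemma markov_swap S D B : markov c P S D B ->
  markov c swapped (swap_vtx @: S)%SET (swap_vtx @: D)%SET (swap_vtx @: B)%SET.
Proof.
apply: (markov_pullback measurable_pair_coordinate
  (@measurable_swap_paths _ X X) _ _ _) => [A mA|[i|i] B' mB'|[i|i] B' mB'];
  last (by exists B'); last (by exists B'); last (by exists B'); last (by exists B').
rewrite /swapped /distribution /pushforward /=; congr (P _).
by apply/seteqP; split=> -[x y].
Qed.

End Swap.

Lemma eq_markov (P : probability Omega R) S D B S' D' B' :
  markov c P S D B -> S = S' -> D = D' -> B = B' -> markov c P S' D' B'.
Proof. by move=> + <- <- <-. Qed.

Lemma compatible_causal (E : rel 'I_n) (E_lt : forall i j, E i j -> (i < j)%N)
    (P : probability Omega R) : compatible (causal_graph E) P (@pair_coordinate _ X X) <->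
  forall u, markov c P [set u]%SET (nondesc (oriented E false) u)
    (parents (oriented E false) u).
Proof.
rewrite -oriented_causal_graph.
exact: (compatible_markov measurable_pair_coordinate base_pair_family
  (orank_lt E_lt (s := false))).
Qed.

(** A larger graph has fewer nondescendants and more parents, and [markovS] allows both changes. *)
Lemma causal_sub (E E' : rel 'I_n) (mu nu : Prob R X) :
  (forall i j, E i j -> E' i j) -> (forall i j, E' i j -> (i < j)%N) ->
  causal E mu nu `<=` causal E' mu nu.
Proof.
move=> EE' E'_lt P [cP]; have E_lt i j : E i j -> (i < j)%N by move=> /EE' /E'_lt.
move=> /(compatible_causal E_lt) M; split => //; apply/(compatible_causal E'_lt) => u.
have sub v w : oriented E false v w -> oriented E' false v w.
  by rewrite /oriented => /orP[/andP[/EE' -> ->]//|->]; rewrite orbT.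
apply: (markovS _ _ _ (@M u)) => //.
- apply/fintype.subsetP => v; rewrite !nondescE => /andP[-> /=]; apply: contraNN.
  move=> /(descendantP _ _ _)[k uk kv]; apply/(descendantP _ _ _); exists k; first exact: sub.
  by apply: connect_sub kv => x y /sub; exact: connect1.
- by apply/fintype.subsetP => v; rewrite !finset.inE; exact: sub.
Qed.

Lemma bicausal_sub (E E' : rel 'I_n) (mu nu : Prob R X) :
  (forall i j, E i j -> E' i j) -> (forall i j, E' i j -> (i < j)%N) ->
  bicausal E mu nu `<=` bicausal E' mu nu.
Proof. by move=> EE' E'_lt P [c1 c2]; split; exact: (causal_sub EE' E'_lt). Qed.

Lemma descendants_homo (W : finType) (f : W -> W) (H H' : rel W) u v :
  v \in descendants H u -> (forall x y, H x y -> H' (f x) (f y)) ->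
  f v \in descendants H' (f u).
Proof.
move=> /descendantP[k uk /connectP[p kp ->]] HH'; apply/descendantP.
exists (f k); first exact: HH'.
elim: p k kp {uk} => [k _|w p IH k /= /andP[kw wp]]; first exact: connect0.
exact: connect_trans (connect1 (HH' _ _ kw)) (IH _ wp).
Qed.

Section Causal.
Variables (E : rel 'I_n) (E_lt : forall i j, E i j -> (i < j)%N).

Lemma causal_markov (mu nu : Prob R X) (P : Prob2 R X X) i :
  ProbG E mu -> causal (@complete_DAG n) mu nu P ->
  markov c P [set inl i]%SET (below_level n i) (side_parents E false i).
Proof.
move=> muE [[P1 P2] compP].
have K_lt (j k : 'I_n) : complete_DAG j k -> (j < k)%N by [].
have M1 := (compatible_causal K_lt P).1 compP (inl i).
have M2 := (compatible_markov measurable_path_coordinate base_coordinate E_lt mu).1 muE i.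
have M3 : markov (@coordinate _ X : forall j, borel (path_space X) -> X j) mu
    [set i]%SET [set j : 'I_n | (j < i)%N]%SET (parents E i).
  apply: (markovS _ _ _ M2) => //.
  apply/fintype.subsetP => j; rewrite finset.inE => ji.
  by apply: (lt_rank_nondesc E_lt (ltnW ji)); apply: contraTneq ji => ->; rewrite ltnn.
have mfst : measurable_fun setT (fst : Omega -> borel (path_space X)).
  by apply: (@continuous_borel (pair_space X X) (path_space X)) => z; exact: cvg_fst.
have M4 : markov c P (inl @: [set i])%SET (inl @: [set j : 'I_n | (j < i)%N])%SET
    (inl @: parents E i)%SET.
  apply: (markov_pullback measurable_path_coordinate mfst _ _ _ M3) => [A mA|j B mB|j B mB].
  - by rewrite -P1.
  - by exists B.
  - by exists B.
have inlE (A : {set 'I_n}) : (inl @: A)%SET = [set u : 'I_n + 'I_n | (side u == false) && (lev u \in A)]%SET.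
  apply/setP => -[j|j]; rewrite finset.inE /=.
  - by rewrite mem_imset //; exact: inl_inj.
  - by apply/negbTE/negP => /imsetP[].
rewrite !inlE in M4.
(* Contraction through the earlier coordinates of the first side: causality discards the second
   side, and compatibility of [mu] then discards the non-parents. *)
apply: (@markov_trans _ _ _ _ _ _ measurable_pair_coordinate P _ _ (side_below n false i)).
- exact: side_parents_side.
- exact: side_below_below.
- apply: (markovS _ _ _ M1) => //.
  + apply/fintype.subsetP => u; rewrite finset.inE => ui.
    apply: (lt_rank_nondesc (orank_lt K_lt (s := false))).
      rewrite /orank /=; case: u ui => j /= ji; rewrite ?addn0 ?addn1 ?leq_double ?ltn_double ?ltn_Sdouble //.
      exact: ltnW.
    by apply: contraTneq ui => ->; rewrite ltnn.
  + rewrite -[inl i]/(vtx false i) parents_first.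
    by apply/fintype.subsetP => u; rewrite !finset.inE.
- have -> : [set inl i]%SET = [set u : 'I_n + 'I_n | (side u == false) && (lev u \in [set i])]%SET.
    by apply/setP => -[j|j]; rewrite !finset.inE.
  apply: (markovS _ _ _ M4) => //.
  + by apply/fintype.subsetP => u; rewrite !finset.inE.
  + by apply/fintype.subsetP => u; rewrite !finset.inE.
Qed.

Hypothesis E_clique : forall i j k, E j i -> E k i -> (j < k)%N -> E j k.

Lemma bicausal_rearrangement (mu nu : Prob R X) (P : Prob2 R X X) :
  ProbG E mu -> ProbG E nu -> bicausal (@complete_DAG n) mu nu P ->
  exists2 rho, bicausal E mu nu rho & forall i, agree c (level i) rho P.
Proof.
move=> muE nuE [cP aP]; have [[P1 P2] _] := cP.
have pi_markov s i : markov c P [set vtx s i]%SET (below_level n i) (side_parents E s i).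
  case: s; last exact: (causal_markov muE cP).
  (* Anticausality is causality of the swapped law with [nu] first; swapping back gives the
     statement for the second side. *)
  have aM := @causal_markov nu mu (swapped P) i nuE aP.
  apply: (eq_markov (markov_unswap aM)).
  - by apply/setP => u; rewrite in_swap_vtx !finset.inE; case: u.
  - by apply/setP => u; rewrite in_swap_vtx !finset.inE; case: u.
  - by apply/setP => u; rewrite in_swap_vtx !finset.inE; case: u.
have [rho [lev_rho side_rho M]] := rearrangement E_lt E_clique measurable_pair_coordinate
  pair_space_gen pair_update_self pair_update_other pair_codes pi_markov.
exists rho; last exact: lev_rho.
split; split.
- split=> A mA.
  + by rewrite -P1 //; apply: (side_rho false); exact: fst_gen.
  + by rewrite -P2 //; apply: (side_rho true); exact: snd_gen.
- by apply/(compatible_causal E_lt) => u; exact: M.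
- split=> A mA.
  + by rewrite -P2 //; apply: (side_rho true); exact: snd_gen.
  + by rewrite -P1 //; apply: (side_rho false); exact: fst_gen.
- apply/(compatible_causal E_lt) => u.
  (* Exchanging the sides turns [oriented E true] into [oriented E false], the graph required of the
     swapped law. *)
  apply: (eq_markov (markov_swap (@M true (swap_vtx u)))).
  + by apply/setP => v; rewrite in_swap_vtx !finset.in_set1 (inj_eq (inv_inj swap_vtxK)).
  + apply/setP => v; rewrite in_swap_vtx !nondescE (inj_eq (inv_inj swap_vtxK)); congr (_ && ~~ _).
    apply/idP/idP => [/(descendants_homo (f := swap_vtx) (H' := oriented E false))|
      /(descendants_homo (f := swap_vtx) (H' := oriented E true))].
      by rewrite !swap_vtxK; apply => -[x|x] [y|y].
    by apply => -[x|x] [y|y].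
  + by apply/setP => v; rewrite in_swap_vtx !finset.inE; case: u v => i [] j.
Qed.

End Causal.

End PairSpace.

(** * The transport cost and the conclusion *)

Lemma measurable_mdist_between (R : realType) d (S : measurableType d)
    (X : pmetricType R) (f g : S -> X) : separable X ->
  measurable_fun setT (f : S -> borel X) -> measurable_fun setT (g : S -> borel X) ->
  measurable_fun setT (fun s => mdist (f s) (g s)).
Proof.
move=> sX mf mg; have [q qD] := dense_seq sX.
have md (m : nat) (h : S -> X) : measurable_fun setT (h : S -> borel X) ->
    measurable_fun setT (fun s => mdist (q m) (h s)).
  move=> mh; apply: (measurability _ (RGenInftyO.measurableE R)) => //.
  move=> _ [_ [t ->] <-]; rewrite (_ : setT `&` _ = setT `&` h @^-1` [set z | mdist (q m) z < t]).
    by apply: mh => //; apply: sub_sigma_algebra; exact: open_mdist_lt.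
  by rewrite !setTI; apply/seteqP; split=> s /=; rewrite in_itv.
pose u (m : nat) s := mdist (q m) (f s) + mdist (q m) (g s).
have u_ge m s : mdist (f s) (g s) <= u m s.
  by rewrite /u (metric_sym (q m) (f s)); exact: metric_triangle.
have u_lb s : has_lbound (range (u ^~ s)).
  by exists (mdist (f s) (g s)) => _ [m _ <-]; exact: u_ge.
rewrite (_ : (fun s => _) = (fun s => infs (u ^~ s) 0)).
  apply: measurable_fun_infs => // m; apply: measurable_funD; exact: md.
apply/funext => s; apply/eqP; rewrite eq_le; apply/andP; split.
  apply: lb_le_inf; first by exists (u 0%N s); exists 0%N.
  by move=> _ [m _ <-]; exact: u_ge.
apply/ler_addgt0Pl => e e0; rewrite addrC.
have e20 : 0 < e / 2 by rewrite divr_gt0.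
have [||m /= qm] := qD [set z : X | mdist (f s) z < e / 2].
- exact: open_mdist_lt.
- by exists (f s) => /=; rewrite mdistxx.
apply: le_trans (_ : u m s <= _).
  apply: ge_inf; last by exists m.
  have [l lP] := u_lb s; exists l => _ [k _ <-]; apply: lP; by exists k.
rewrite /u; have := metric_triangle (q m) (f s) (g s).
rewrite (metric_sym (q m) (f s)); lra.
Qed.

Section Cost.
Context (R : realType) (n : nat) (X : 'I_n -> pmetricType R).
Hypothesis X_polish : forall i, polish (X i).
Variables (p : R) (dX : path_space X -> path_space X -> R).
Hypothesis dX_sum : forall x y : path_space X,
  dX x y `^ p = \sum_(i < n) mdist (x i) (y i) `^ p.

Local Notation Omega := (borel (pair_space X X)).
Local Notation T := (pair_family X X).
Local Notation c := (@pair_coordinate _ X X : forall u, Omega -> T u).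

(** Each summand of the cost depends on a single pair of coordinates, so the laws of the individual
    pairs determine the integral. *)
Lemma integral_cost_agree (P Q : Prob2 R X X) :
  (forall i, agree c (level i) P Q) ->
  (\int[P]_z (dX z.1 z.2 `^ p)%:E = \int[Q]_z (dX z.1 z.2 `^ p)%:E)%E.
Proof.
move=> PQ.
pose t (i : 'I_n) (z : Omega) := mdist (z.1 i) (z.2 i) `^ p.
have Gm := gen_measurable (@measurable_pair_coordinate R n X).
have mt i : sub_measurable (gen c (level i)) (t i).
  apply: (@measurableT_comp _ _ _ _ _ _ (fun r : R => r `^ p)); first exact: measurable_powR.
  apply: measurable_mdist_between; first by case: (X_polish i).
  - move=> _ B mB; rewrite setTI.
    by apply: (@gen_coord _ T _ Omega c _ (inl i) B) => //; rewrite finset.inE.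
  - move=> _ B mB; rewrite setTI.
    by apply: (@gen_coord _ T _ Omega c _ (inr i) B) => //; rewrite finset.inE.
have sumE (M : Prob2 R X X) :
    (\int[M]_z (dX z.1 z.2 `^ p)%:E = \sum_(i < n) \int[M]_z (t i z)%:E)%E.
  rewrite -ge0_integral_sum //.
  - by apply: eq_integral => z _; rewrite dX_sum sumEFin.
  - by move=> i; apply/measurable_EFinP; exact: (measurable_of_sub (@Gm _) (mt i)).
  - by move=> i z _; rewrite lee_fin powR_ge0.
rewrite !sumE; apply: eq_bigr => i _; apply: (integral_agree (@Gm (level i))) => //.
- exact: PQ.
- exact: (@measurableT _ (g_sigma_algebraType _)).
- exact/measurable_EFinP.
- by move=> z; rewrite lee_fin powR_ge0.
Qed.

End Cost.

Theorem theorem5p4 (R : realType) (n : nat) (E : rel 'I_n)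
  (E_dag : is_DAG E) (E_sorted : sorted_graph E) (E_perfect : perfect E)
  (X : 'I_n -> pmetricType R) (X_polish : forall i, polish (X i))
  (p : R) (p_ge1 : 1 <= p)
  (dX : path_space X -> path_space X -> R) (dX_metric : is_metric dX)
  (dX_sum : forall x y : path_space X,
     dX x y `^ p = \sum_(i < n) mdist (x i) (y i) `^ p)
  (mu nu : Prob R X) (mu_G : ProbGp p dX E mu) (nu_G : ProbGp p dX E nu) :
  WG p dX E mu nu = AW p dX mu nu.
Proof.
have E_lt i j : E i j -> (i < j)%N by move=> ij; apply: E_sorted; rewrite finset.inE.
have E_clique i j k : E j i -> E k i -> (j < k)%N -> E j k.
  move=> ji ki jk; apply/negP => /negP njk; apply: (E_perfect i j k); split.
  - by rewrite neq_ltn jk.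
  - by rewrite finset.inE.
  - by rewrite finset.inE.
  - by rewrite finset.inE.
  (* Sortedness excludes the edge from [k] to [j], so a missing edge from [j] to [k] would make a
     merge. *)
  - by rewrite finset.inE; apply/negP => /E_lt; rewrite ltnNge (ltnW jk).
(* The two sets of attainable costs coincide, not only their infima, so no minimising sequence is
   needed. *)
have costE : [set (\int[P]_z (dX z.1 z.2 `^ p)%:E)%E | P in bicausal E mu nu] =
    [set (\int[P]_z (dX z.1 z.2 `^ p)%:E)%E | P in bicausal (@complete_DAG n) mu nu].
  apply/seteqP; split=> _ [P cP <-].
  - exists P; last by [].
    exact: (bicausal_sub X_polish E_lt (fun _ _ => id) cP).
  - have [rho rhoE PQ] := bicausal_rearrangement X_polish E_lt E_clique mu_G.1 nu_G.1 cP.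
    by exists rho; last exact: integral_cost_agree PQ.
exact: (congr1 (fun S => (ereal_inf S `^ p^-1)%E) costE).
Qed.
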